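(* Let $F\in S$ be a homogeneous polynomial such that \[F^\perp=(q^a,g_1,\ldots,g_n)\] is a complete intersection with $q,g_1,\ldots,g_n$ homogeneous, $a\geq 2$, $e=\deg q>0$ and $ae \leq d_1=\deg g_1\leq\cdots \leq d_n=\deg g_n$. Then $F$ is $e$-computable, its rank is computed by $q$, and \[\mathrm{rk} (F)=\prod_{i=1}^n d_i=\frac1e \sum_{i=0}^\infty HF\big(T/((F^\perp:(q)) + (q)),i \big).\]
   Context: $k$ is algebraically closed of characteristic zero, $S=k[x_0,\ldots,x_n]$, $T=k[X_0,\ldots,X_n]$ acting on $S$ by differentiation ($X_i\circ F=\partial F/\partial x_i$), $F^\perp=\{g\in T:g\circ F=0\}$, $HF(T/J,i)=\dim_kT_i-\dim_kJ_i$, and $\mathrm{rk}(F)$ is the least $r$ with $F=\sum_{j=1}^rL_j^{\deg F}$, $L_j\in S_1$. A form $F$ is $e$-computable if there is a homogeneous ideal $I\subset T$ generated in degree $e$ such that for a general $t\in I_e$ (i.e. $t$ in a nonempty Zariski-open subset of $I_e$) $\mathrm{rk}(F)=\frac1e\sum_{i=0}^\infty HF(T/((F^\perp:I)+(t)),i)$; ''the rank is computed by $q$'' means this holds with $I=(q)$ (so the general element of $I_e$ is a nonzero multiple of $q$). *)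

(* Defs.v *)
From HB Require Import structures.
From mathcomp Require Import all_boot all_order all_algebra.
From mathcomp Require Import mpoly.
From Stdlib Require Import ClassicalEpsilon.

Set Implicit Arguments.
Unset Strict Implicit.
Unset Printing Implicit Defensive.

Import Order.TTheory GRing.Theory.
Local Open Scope ring_scope.

Section Apolarity.
Variables (k : fieldType) (N : nat).
Local Notation P := {mpoly k[N]}.

Definition apolar (g F : P) : P := \sum_(m <- msupp g) g@_m *: mderivm m F.

(* Subsets of T (= S as a type) are predicates. *)
Definition perp (F : P) : P -> Prop := fun g => apolar g F = 0.

Definition ideal_of (gs : seq P) : P -> Prop :=
  fun p => exists c : 'I_(size gs) -> P, p = \sum_(i < size gs) c i * gs`_i.

Definition regular_seq (gs : seq P) : Prop :=
  ~ ideal_of gs 1 /\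
  forall (i : 'I_(size gs)) (h : P),
    ideal_of (take i gs) (gs`_i * h) -> ideal_of (take i gs) h.

Definition complete_intersection_by (J : P -> Prop) (gs : seq P) : Prop :=
  (forall p, J p <-> ideal_of gs p) /\ regular_seq gs.

Definition colon (J I : P -> Prop) : P -> Prop :=
  fun g => forall f, I f -> J (g * f).

Definition add_principal (J : P -> Prop) (t : P) : P -> Prop :=
  fun p => exists a b, J a /\ p = a + b * t.

Definition lin_indep (r : nat) (v : 'I_r -> P) : Prop :=
  forall c : 'I_r -> k, \sum_(i < r) c i *: v i = 0 -> forall i, c i = 0.

Definition has_dim (A : P -> Prop) (r : nat) : Prop :=
  (exists v : 'I_r -> P, (forall i, A (v i)) /\ lin_indep v) /\
  (forall v : 'I_r.+1 -> P, (forall i, A (v i)) -> ~ lin_indep v).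

Definition dimk (A : P -> Prop) : nat :=
  match excluded_middle_informative (exists r, has_dim A r) with
  | left h => proj1_sig (constructive_indefinite_description _ h)
  | right _ => 0%N
  end.

Definition degpart (A : P -> Prop) (i : nat) : P -> Prop :=
  fun p => A p /\ p \is i.-homog.

Definition HF (J : P -> Prop) (i : nat) : nat :=
  (dimk (degpart (fun _ => True) i) - dimk (degpart J i))%N.

Definition HFsum (J : P -> Prop) : nat :=
  match excluded_middle_informative
          (exists M : nat, forall i, (M <= i)%N -> HF J i = 0%N) with
  | left h => (\sum_(i < proj1_sig (constructive_indefinite_description _ h))
                 HF J i)%N
  | right _ => 0%N
  end.

Definition power_sum_len (F : P) (r : nat) : Prop :=
  exists L : 'I_r -> P, (forall j, L j \is 1.-homog) /\
    F = \sum_(j < r) (L j) ^+ (msize F).-1.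

Definition wrank (F : P) : nat :=
  match excluded_middle_informative (exists r, power_sum_len F r) with
  | left h =>
      let b := fun r => if excluded_middle_informative (power_sum_len F r)
                        then true else false in
      let h' : exists r, b r := match h with
        | ex_intro r hr => ex_intro (fun r => b r) r
             (match excluded_middle_informative (power_sum_len F r) as o
                return (if o then true else false) with
              | left _ => is_true_true | right nh => False_ind _ (nh hr) end)
        end in
      ex_minn h'
  | right _ => 0%N
  end.

(* rk(F) = 1/e * sum_i HF(T/((F^perp : I) + (t)), i) for t general in I_e,
   where I = (hs) and t = sum_j c_j hs_j; "general" = outside the zero set
   of some nonzero polynomial in the coordinates c. *)
Definition computes (F : P) (e : nat) (hs : seq P) : Prop :=
  exists Q : {mpoly k[size hs]}, Q != 0 /\
    forall c : 'I_(size hs) -> k, Q.@[c] != 0 ->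
      ((wrank F)%:R : rat) =
        (e%:R)^-1 * (HFsum (add_principal (colon (perp F) (ideal_of hs))
                        (\sum_(j < size hs) c j *: hs`_j)))%:R.

(* F is e-computable: some ideal I generated in degree e (by a basis hs of I_e) *)
Definition e_computable (F : P) (e : nat) : Prop :=
  exists hs : seq P, (forall j : 'I_(size hs), hs`_j \is e.-homog) /\
    lin_indep (fun j : 'I_(size hs) => hs`_j) /\ computes F e hs.

Definition computed_by (F q : P) : Prop := computes F (msize q).-1 [:: q].

End Apolarity.

(* Main.v *)
(** The ideal (q, g_1, ..., g_n) is again a complete intersection, so its
    quotient has length e d_1 ... d_n, and it equals (F^perp : q) + (q).

    Lower bound: if F is a sum of r powers of linear forms, let K be the ideal
    of those of the r points where q does not vanish.  Then q is a
    nonzerodivisor modulo K and K + (q) is contained in (q, g_1, ..., g_n), so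
    the length e d_1 ... d_n is at most e r.

    Upper bound: deform g_i to G_i = g_i - h_i q^a / t^a, where the h_i are
    generic combinations of powers of the variables and t is generic.  These
    still lie in F^perp, and the affine scheme q = t, G_i = 0 has length at most
    e d_1 ... d_n.  To see that it is reduced for generic parameters without
    appealing to Bertini's theorem, look at the discriminant of its trace form,
    a polynomial in the parameters.  If it were zero, there would be a nonzero
    polynomial family of nilpotents (characteristic 0); but where a variable is
    invertible the parameters can be solved for, so the total space of the
    deformation is an affine space there, and the family vanishes.  The points
    come in orbits under the e-th roots of unity, which leaves at most
    d_1 ... d_n points in projective space, and F is a combination of the
    corresponding powers because every form of degree D vanishing at them lies
    in (G_1, ..., G_n), hence in F^perp. *)

Require Import Defs.
From HB Require Import structures.
From mathcomp Require Import all_boot all_order all_algebra.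
From mathcomp Require Import ssrcomplements mpoly.
From mathcomp Require Import separable cyclotomic.
From mathcomp Require Import ring zify.
From Stdlib Require Import ClassicalEpsilon FunctionalExtensionality
  PropExtensionality.

Set Implicit Arguments.
Unset Strict Implicit.
Unset Printing Implicit Defensive.

Import GRing.Theory.
Local Open Scope ring_scope.

(** * Graded ideals and regular sequences *)

Lemma pred_ext (T : Type) (A B : T -> Prop) : (forall x, A x <-> B x) -> A = B.
Proof.
by move=> AB; apply: functional_extensionality => x;
   apply: propositional_extensionality.
Qed.

Section Ideals.
Variables (k : fieldType) (N : nat).
Local Notation P := {mpoly k[N]}.
Local Notation pi := (pihomog mdeg).
Implicit Types (J : P -> Prop) (p q f x y : P) (s : seq P).

Lemma pihomog_mul d e b f : f \is e.-homog ->
  pi d (b * f) = if (e <= d)%N then pi (d - e) b * f else 0.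
Proof.
move=> hf.
have h c m : pi d (c *: 'X_[m] * f) =
    if (e <= d)%N then pi (d - e) (c *: 'X_[m]) * f else 0.
  have hm : (c *: 'X_[m]) * f \is (mdeg m + e).-homog.
    by apply: dhomogM => //; apply: rpredZ; rewrite dhomogX.
  have hX : c *: 'X_[m] \is (mdeg m).-homog.
    by apply: rpredZ; rewrite dhomogX.
  case: (altP ((mdeg m + e)%N =P d)) => [<-|ne].
    by rewrite leq_addl addnK !pihomog_dE.
  rewrite (pihomog_ne0 ne hm); case: leqP => // le.
  by rewrite (pihomog_ne0 _ hX) ?mul0r // -(eqn_add2r e) subnK.
rewrite [b in LHS]mpolyE [b in RHS]mpolyE.
elim: (msupp b) => [|m r IH].
  by rewrite !big_nil mul0r !raddf0 mul0r if_same.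
rewrite !big_cons mulrDl !raddfD /= h IH.
by case: ifP => _; rewrite ?addr0 // mulrDl.
Qed.

Record ideal J : Prop := Ideal {
  ideal0 : J 0;
  idealD : forall p q, J p -> J q -> J (p + q);
  idealMl : forall p q, J q -> J (p * q) }.

Lemma ideal_mulr J p q : ideal J -> J p -> J (p * q).
Proof. by move=> [_ _ m] Jp; rewrite mulrC; apply: m. Qed.

Lemma idealN J p : ideal J -> J p -> J (- p).
Proof. by move=> [_ _ m] Jp; rewrite -mulN1r; apply: m. Qed.

Lemma idealB J p q : ideal J -> J p -> J q -> J (p - q).
Proof. by move=> hJ Jp Jq; apply: idealD => //; apply: idealN. Qed.

Lemma idealZ J c p : ideal J -> J p -> J (c *: p).
Proof. by move=> hJ Jp; rewrite -mul_mpolyC; apply: idealMl. Qed.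

Lemma ideal_sum J (I : Type) (r : seq I) (Q : pred I) (F : I -> P) :
  ideal J -> (forall i, Q i -> J (F i)) -> J (\sum_(i <- r | Q i) F i).
Proof.
by move=> hJ hF; apply: (big_ind J) => //;
  [apply: ideal0 | move=> ? ?; apply: idealD].
Qed.

Lemma ideal_sub_trans J p q : ideal J -> J (p - q) -> J q -> J p.
Proof. by move=> hJ h1 h2; rewrite -(subrK q p); apply: idealD. Qed.

Definition graded J := forall d p, J p -> J (pi d p).

Lemma graded_pihomog J p : ideal J -> (forall d, J (pi d p)) -> J p.
Proof.
move=> hJ h; rewrite (@pihomog_partitionE _ _ mdeg _ p (leqnn _)).
by apply: ideal_sum.
Qed.

Lemma zero_ideal : ideal (fun p : P => p = 0).
Proof. by split=> [|p q -> ->|p q ->]; rewrite ?addr0 ?mulr0. Qed.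

Lemma zero_graded : graded (fun p : P => p = 0).
Proof. by move=> d p ->; rewrite raddf0. Qed.

Lemma add_principal_ideal J f : ideal J -> ideal (add_principal J f).
Proof.
move=> hJ; split.
- by exists 0, 0; rewrite mul0r addr0; split => //; apply: ideal0.
- move=> _ _ [a [b [Ja ->]]] [a' [b' [Ja' ->]]].
  exists (a + a'), (b + b'); split; first exact: idealD.
  by rewrite mulrDl addrACA.
- move=> p _ [a [b [Ja ->]]]; exists (p * a), (p * b); split.
    exact: idealMl.
  by rewrite mulrDr mulrA.
Qed.

Lemma add_principal_graded J f e :
  ideal J -> graded J -> f \is e.-homog -> graded (add_principal J f).
Proof.
move=> hJ gJ hf d _ [a [b [Ja ->]]]; rewrite raddfD /= (pihomog_mul _ _ hf).
exists (pi d a), (if (e <= d)%N then pi (d - e) b else 0).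
by split; [apply: gJ | case: ifP => // _; rewrite mul0r].
Qed.

Lemma add_principal_sub J f p : J p -> add_principal J f p.
Proof. by move=> Jp; exists p, 0; rewrite mul0r addr0. Qed.

Lemma add_principal_mul J f p : ideal J -> add_principal J f (p * f).
Proof.
by move=> hJ; exists 0, p; rewrite add0r; split => //; apply: ideal0.
Qed.

Lemma add_principal_gen J f : ideal J -> add_principal J f f.
Proof. by move=> hJ; rewrite -[X in add_principal _ _ X]mul1r; apply: add_principal_mul. Qed.

Lemma add_principal_min J J' f : ideal J' -> (forall p, J p -> J' p) ->
  J' f -> forall p, add_principal J f p -> J' p.
Proof.
move=> hJ' sub J'f _ [a [b [Ja ->]]].
by apply: idealD => //; [apply: sub | apply: idealMl].
Qed.

Lemma add_principalC J x y : ideal J ->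
  add_principal (add_principal J x) y = add_principal (add_principal J y) x.
Proof.
move=> hJ; apply: pred_ext => p; split.
- move=> [_ [b [[a [c [Ja ->]]] ->]]]; exists (a + b * y), c.
  by split; [exists a, b | rewrite addrAC].
- move=> [_ [b [[a [c [Ja ->]]] ->]]]; exists (a + b * x), c.
  by split; [exists a, b | rewrite addrAC].
Qed.

Lemma add_principal_congr J x y : ideal J -> J (x - y) ->
  add_principal J x = add_principal J y.
Proof.
move=> hJ Jxy; apply: pred_ext => p; split; apply: add_principal_min;
  try exact: add_principal_ideal; try exact: add_principal_sub.
- apply: (ideal_sub_trans (add_principal_ideal y hJ) _ (add_principal_gen y hJ)).
  exact: add_principal_sub.
- apply: (ideal_sub_trans (add_principal_ideal x hJ) _ (add_principal_gen x hJ)).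
  by apply: add_principal_sub; rewrite -opprB; apply: idealN.
Qed.

(** Generators are adjoined one at a time to a base ideal [J], so that statements about sequences go
    by induction with the base varying; the base zero gives the ideal generated by [s]. *)
Definition gen_over J s := foldl (@add_principal k N) J s.

Lemma gen_over_ideal J s : ideal J -> ideal (gen_over J s).
Proof.
by elim: s J => [|f s IH] J hJ //=; apply: IH; apply: add_principal_ideal.
Qed.

Lemma gen_over_sub J s p : J p -> gen_over J s p.
Proof.
by elim: s J => [|f s IH] J Jp //=; apply: IH; apply: add_principal_sub.
Qed.

Lemma gen_over_mem J s f : ideal J -> f \in s -> gen_over J s f.
Proof.
elim: s J => [|g s IH] J hJ //=; rewrite in_cons => /orP[/eqP ->|fs].
  by apply: gen_over_sub; apply: add_principal_gen.
by apply: IH => //; apply: add_principal_ideal.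
Qed.

Lemma gen_over_min J J' s : ideal J' -> (forall p, J p -> J' p) ->
  {in s, forall f, J' f} -> forall p, gen_over J s p -> J' p.
Proof.
move=> hJ'; elim: s J => [|f s IH] J sub h p /=; first exact: sub.
apply: IH; last by move=> g gs; apply: h; rewrite in_cons gs orbT.
by apply: add_principal_min => //; apply: h; rewrite mem_head.
Qed.

Lemma gen_over_graded J s : ideal J -> graded J ->
  {in s, forall f, exists e, f \is e.-homog} -> graded (gen_over J s).
Proof.
elim: s J => [|f s IH] J hJ gJ hs //=.
have [e he] := hs f (mem_head _ _).
apply: IH; first exact: add_principal_ideal.
  exact: add_principal_graded he.
by move=> g gs; apply: hs; rewrite in_cons gs orbT.
Qed.

Lemma gen_over_add J s f : ideal J ->
  gen_over (add_principal J f) s = add_principal (gen_over J s) f.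
Proof.
elim: s J => [|g s IH] J hJ //=.
by rewrite add_principalC // IH //; apply: add_principal_ideal.
Qed.

Notation gen := (gen_over (fun p : P => p = 0)).

Lemma ideal_ofE s : ideal_of s = gen s.
Proof.
apply: pred_ext => p; split.
  move=> [c ->]; apply: ideal_sum => [|i _].
    exact/gen_over_ideal/zero_ideal.
  apply: idealMl; first exact/gen_over_ideal/zero_ideal.
  by apply: gen_over_mem; [apply: zero_ideal | apply: mem_nth].
have idl : ideal (ideal_of s).
  split.
  - by exists (fun=> 0); rewrite big1 // => i _; rewrite mul0r.
  - move=> _ _ [c ->] [c' ->]; exists (fun i => c i + c' i).
    by rewrite -big_split /=; apply: eq_bigr => i _; rewrite mulrDl.
  - move=> q _ [c ->]; exists (fun i => q * c i).
    by rewrite mulr_sumr; apply: eq_bigr => i _; rewrite mulrA.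
apply: gen_over_min => //; first by move=> _ ->; apply: ideal0.
move=> f /(nthP 0)[i lti <-]; exists (fun j => (j == i :> nat)%:R).
rewrite (bigD1 (Ordinal lti)) //= eqxx mul1r big1 ?addr0 // => j.
by rewrite -val_eqE /= => /negPf ->; rewrite mul0r.
Qed.

(** Only the nonzerodivisor half of regularity, relative to a base ideal; properness is carried
    separately because the permutation arguments below concern this half alone. *)
Fixpoint regular_over J s : Prop :=
  if s is f :: s' then
    (forall h, J (f * h) -> J h) /\ regular_over (add_principal J f) s'
  else True.

Lemma regular_seq_over s : regular_seq s -> regular_over (fun p => p = 0) s.
Proof.
move=> [_ reg].
(* Induction on the length [i] of the tail still to be treated, over the ideal of the preceding
   entries. *)
have h i : (i <= size s)%N ->
    regular_over (gen (take (size s - i) s)) (drop (size s - i) s).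
  elim: i => [|i IH] lei; first by rewrite subn0 drop_size.
  have lt : (size s - i.+1 < size s)%N by rewrite ltn_subrL; lia.
  rewrite (drop_nth 0) //=; split.
    by move=> h; have := reg (Ordinal lt) h; rewrite /= !ideal_ofE.
  have -> : (size s - i.+1).+1 = (size s - i)%N by lia.
  have <- : gen (take (size s - i) s) =
    add_principal (gen (take (size s - i.+1) s)) s`_(size s - i.+1).
    have -> : (size s - i)%N = (size s - i.+1).+1 by lia.
    by rewrite (take_nth 0) // /gen_over foldl_rcons.
  by apply: IH; lia.
by have := h _ (leqnn _); rewrite subnn take0 drop0.
Qed.

Lemma regular_over_cat J s1 s2 :
  regular_over J (s1 ++ s2) <->
  regular_over J s1 /\ regular_over (gen_over J s1) s2.
Proof.
elim: s1 J => [|f s1 IH] J /=; first by tauto.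
by rewrite IH; tauto.
Qed.

(** Regular sequences of forms can be permuted. If [y * h] is in [J], then regularity of [y] modulo
    [x] gives [h = a + b * x], and cancelling [x] gives [y * b] in [J]; as [0 < dx], the degree of
    [b] is smaller and induction on degree applies. *)
Lemma regular_swap J x y dx dy :
  ideal J -> graded J -> x \is dx.-homog -> y \is dy.-homog -> (0 < dx)%N ->
  regular_over J [:: x; y] -> regular_over J [:: y; x].
Proof.
move=> hJ gJ hx hy dx0 /= [rx [ry _]].
have ry0 i h : h \is i.-homog -> J (y * h) -> J h.
  elim/ltn_ind: i h => i IH h hh Jyh.
  have [a [b [Ja eh]]] := ry h (add_principal_sub x Jyh).
  have {}eh : h = pi i a + if (dx <= i)%N then pi (i - dx) b * x else 0.
    by rewrite -(pihomog_mul i b hx) -raddfD /= -eh pihomog_dE.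
  case: leqP eh => [le|lt] eh; last by rewrite eh addr0; apply: gJ.
  have Jb : J (pi (i - dx) b).
    apply: (IH (i - dx)%N); [lia | exact: pihomogP | apply: rx].
    have -> : x * (y * pi (i - dx) b) = y * h - y * pi i a.
      by rewrite [in RHS]eh; ring.
    by apply: idealB => //; apply: idealMl => //; apply: gJ.
  by rewrite eh; apply: idealD; [| apply: gJ | apply: ideal_mulr].
have {}ry0 h : J (y * h) -> J h.
  move=> Jyh; apply: graded_pihomog => // d; apply: (ry0 d).
    exact: pihomogP.
  have := gJ (d + dy)%N _ Jyh.
  by rewrite mulrC (pihomog_mul _ _ hy) leq_addl addnK mulrC.
(* Here [x * h = j + u * y]. Modulo [x] this says that [y * u] vanishes, so [u = j' + u' * x], and
   cancelling [x] leaves [h - y * u'] in [J]. *)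
split=> //; split=> // h [j [u [Jj e]]].
have : add_principal J x (y * u).
  exists (- j), h; split; first exact: idealN.
  by rewrite [h * x]mulrC e; ring.
move/ry => [j' [u' [Jj' eu]]].
have Jhu : J (h - y * u').
  apply: rx; have -> : x * (h - y * u') = j + j' * y.
    by rewrite mulrBr e eu; ring.
  by apply: idealD => //; apply: ideal_mulr.
by exists (h - y * u'), u'; split => //; ring.
Qed.

(** The first entry is carried past the others by successive swaps. It is applied to the power of
    [q], to make [q] a nonzerodivisor modulo the remaining generators. *)
Lemma regular_rot J x s dx :
  ideal J -> graded J -> x \is dx.-homog -> (0 < dx)%N ->
  {in s, forall f, exists e, f \is e.-homog} ->
  regular_over J (x :: s) -> regular_over J (rcons s x).
Proof.
move=> hJ gJ hx dx0; elim: s J hJ gJ => [|f s IH] J hJ gJ hs //= [rx [rf rs]].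
have [e he] := hs f (mem_head _ _).
have [rf' [rx' _]] : regular_over J [:: f; x].
  exact: (regular_swap hJ gJ hx he dx0).
split=> //; apply: IH.
- exact: add_principal_ideal.
- exact: add_principal_graded he.
- by move=> g gs; apply: hs; rewrite in_cons gs orbT.
- by split=> //; rewrite add_principalC.
Qed.

Lemma nonzerodiv_root J x m : ideal J -> (0 < m)%N ->
  (forall h, J (x ^+ m * h) -> J h) -> forall h, J (x * h) -> J h.
Proof.
case: m => // m hJ _ rx h Jxh; apply: rx.
by rewrite exprSr -mulrA; apply: idealMl.
Qed.

(** Each entry may be changed by a multiple of [x] because [x] is already in the base ideal: no
    ideal along the sequence changes. *)
Lemma regular_congr J x s s' : ideal J -> J x -> size s = size s' ->
  (forall i, (i < size s)%N -> add_principal (fun p => p = 0) x (s`_i - s'`_i)) ->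
  regular_over J s -> regular_over J s'.
Proof.
move=> hJ Jx; elim: s s' J hJ Jx => [|f s IH] [|f' s'] J hJ Jx //= [es] h [rf rs].
have Jff : J (f - f').
  apply: add_principal_min (h 0%N isT) => //; by move=> _ ->; apply: ideal0.
split.
  move=> g Jg; apply: rf; apply: (ideal_sub_trans hJ _ Jg).
  by rewrite -mulrBl; apply: ideal_mulr.
rewrite -(add_principal_congr hJ Jff); apply: IH => //.
- exact: add_principal_ideal.
- exact: add_principal_sub.
- by move=> i lti; apply: (h i.+1).
Qed.

Lemma regular_mod_congr x s s' : size s = size s' ->
  (forall i, (i < size s)%N -> add_principal (fun p => p = 0) x (s`_i - s'`_i)) ->
  regular_over (fun p => p = 0) (x :: s) -> regular_over (fun p => p = 0) (x :: s').
Proof.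
move=> es h /= [rx rs]; split=> //; apply: (regular_congr _ _ es h rs).
  exact/add_principal_ideal/zero_ideal.
exact/add_principal_gen/zero_ideal.
Qed.

End Ideals.

Notation gen := (gen_over (fun p => p = 0)).

(** * Hilbert functions *)

(** Membership in [A] is not decidable, so the subspace is found classically: a subspace inside [A]
    is enlarged by a missing vector until none is left, which takes at most as many steps as its
    codimension. *)
Lemma vspace_of_pred (K : fieldType) (vT : vectType K) (A : vT -> Prop) :
  A 0 -> (forall a u v, A u -> A v -> A (a *: u + v)) ->
  exists U : {vspace vT}, forall v, v \in U <-> A v.
Proof.
move=> A0 Alin.
suff [U [sU maxU]] : exists U : {vspace vT}, (forall v, v \in U -> A v) /\
    (forall v, A v -> v \in U).
  by exists U => v; split; [apply: sU | apply: maxU].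
have h m : forall U : {vspace vT}, (forall v, v \in U -> A v) ->
    (\dim (fullv : {vspace vT}) - \dim U <= m)%N ->
    exists U : {vspace vT}, (forall v, v \in U -> A v) /\
      (forall v, A v -> v \in U).
  elim: m => [|m IH] U sU hm.
    exists U; split=> // v _.
    suff -> : U = fullv by rewrite memvf.
    by apply/eqP; rewrite eqEdim subvf /= -subn_eq0 -leqn0.
  have [all|] := excluded_middle_informative (forall v, A v -> v \in U).
    by exists U.
  move/not_all_ex_not => [v] /(@imply_to_and (A v) _) [Av /negP vU].
  apply: (IH (U + <[v]>)%VS).
    move=> _ /memv_addP [u uU [_ /vlineP [c ->] ->]].
    by rewrite addrC; apply: Alin => //; apply: sU.
  have lt : (\dim U < \dim (U + <[v]>)%VS)%N.
    rewrite ltn_neqAle dimvS ?addvSl // andbT.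
    apply: contra vU => /eqP ed.
    have : U == (U + <[v]>)%VS by rewrite eqEdim addvSl ed leqnn.
    by move/eqP ->; apply: subvP (addvSr _ _) _ (memv_line v).
  by have := dimvS (subvf (U + <[v]>)%VS); lia.
apply: (h _ 0%VS _ (leqnn _)) => v; rewrite memv0 => /eqP -> //.
Qed.

Section Hilbert.
Variables (k : fieldType) (n : nat).
Local Notation P := {mpoly k[n.+1]}.
Local Notation V d := (dhomog n.+1 k d).
Local Notation pi := (pihomog mdeg).

Lemma has_dim_uniq (A : P -> Prop) r s : has_dim A r -> has_dim A s -> r = s.
Proof.
wlog: r s / (r <= s)%N => [h hr hs|].
  by case: (leqP r s) => [le|/ltnW le]; [|apply/esym]; apply: h.
rewrite leq_eqVlt => /orP[/eqP //|lt] [_ max] [[v [Av iv]] _].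
exfalso; apply: (max (fun i : 'I_r.+1 => v (widen_ord lt i))) => // c hc i.
(* Coefficients on the first [r.+1] vectors are extended by zero to all [s] of them. *)
pose c' (j : 'I_s) := \sum_(i < r.+1 | widen_ord lt i == j) c i.
have ec : c' (widen_ord lt i) = c i.
  rewrite /c' (bigD1 i) //= big1 ?addr0 // => j /andP[/eqP].
  by move/(congr1 val) => /= e /eqP []; apply: val_inj.
rewrite -ec; apply: iv; rewrite -[RHS]hc.
rewrite [RHS](partition_big (widen_ord lt) xpredT) //=.
apply: eq_bigr => j _; rewrite scaler_suml; apply: eq_bigr => i0 /eqP -> //.
Qed.

Lemma dimk_vspace (A : P -> Prop) d (U : {vspace V d}) :
  (forall v : V d, v \in U <-> A (val v)) -> dimk (degpart A d) = \dim U.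
Proof.
move=> hU.
have hd : has_dim (degpart A d) (\dim U).
  split.
    exists (fun i => val ((vbasis U)`_i)); split.
      move=> i; split; last exact: valP.
      by apply/hU/vbasis_mem/mem_nth; rewrite size_tuple.
    move=> c hc; have /freeP fr := basis_free (vbasisP U).
    apply: fr; apply: val_inj; rewrite raddf_sum /= -[RHS]hc.
    by apply: eq_bigr => i _.
  move=> v hv iv.
  pose w : (\dim U).+1.-tuple (V d) :=
    [tuple DHomog (proj2 (hv i)) | i < (\dim U).+1].
  have fr : free w.
    apply/freeP => c hc; apply: iv; rewrite -[RHS](congr1 val hc).
    rewrite raddf_sum; apply: eq_bigr => i _.
    by rewrite (nth_map i) ?size_enum_ord // nth_ord_enum.
  have : (\dim <<w>> <= \dim U)%N.
    apply/dimvS/span_subvP => _ /mapP [i _ ->].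
    by apply/hU; have [] := hv i.
  by move: fr; rewrite /free => /eqP ->; rewrite size_tuple ltnn.
rewrite /dimk; case: excluded_middle_informative => [h|]; last first.
  by case; exists (\dim U).
by case: constructive_indefinite_description => r hr /=; apply: has_dim_uniq hd.
Qed.

Lemma hspace_exists (J : P -> Prop) d : ideal J ->
  exists U : {vspace V d}, forall v : V d, v \in U <-> J (val v).
Proof.
move=> hJ; apply: vspace_of_pred; first exact: (ideal0 hJ).
by move=> a u v Ju Jv; rewrite linearP; apply: idealD => //; apply: idealZ.
Qed.

Lemma dim_hom d : \dim (fullv : {vspace V d}) = 'C(d + n, d).
Proof. by rewrite dimvf. Qed.

Lemma dimk_all d : dimk (degpart (fun _ : P => True) d) = 'C(d + n, d).
Proof. by rewrite (@dimk_vspace _ _ fullv) ?dim_hom // => v; rewrite memvf. Qed.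

Lemma dimk_le (J : P -> Prop) d : ideal J ->
  (dimk (degpart J d) <= 'C(d + n, d))%N.
Proof.
move=> hJ; have [U hU] := hspace_exists d hJ.
by rewrite (dimk_vspace hU) -dim_hom dimvS // subvf.
Qed.

Lemma dimk_mono (J J' : P -> Prop) d : ideal J -> ideal J' ->
  (forall p, p \is d.-homog -> J p -> J' p) ->
  (dimk (degpart J d) <= dimk (degpart J' d))%N.
Proof.
move=> hJ hJ' s; have [U hU] := hspace_exists d hJ.
have [U' hU'] := hspace_exists d hJ'.
rewrite (dimk_vspace hU) (dimk_vspace hU') dimvS //.
by apply/subvP => v /hU Jv; apply/hU'/s => //; apply: valP.
Qed.

Section AddPrincipal.
Variables (J : P -> Prop) (f : P) (e : nat).
Hypotheses (hJ : ideal J) (gJ : graded J) (hf : f \is e.-homog) (f0 : f != 0).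
Hypothesis (rf : forall h, J (f * h) -> J h).

Lemma homog_mul_proof d (v : V d) : val v * f \is (d + e).-homog.
Proof. by apply: dhomogM => //; apply: valP. Qed.

Definition homog_mul d (v : V d) : V (d + e) := DHomog (homog_mul_proof v).

Fact homog_mul_is_linear d : linear (@homog_mul d).
Proof. by move=> a u v; apply: val_inj; rewrite /= mulrDl -scalerAl. Qed.

HB.instance Definition _ d := GRing.isLinear.Build k (V d) (V (d + e)) _
  (@homog_mul d) (@homog_mul_is_linear d).

(** In degree [d + e] the new ideal is the sum of the degree part of [J] and the image of
    multiplication by [f]. Regularity identifies their intersection with [f] times the part of [J]
    in degree [d], and the dimension formula for sums does the rest. *)
Lemma dimk_add_principal d :
  (dimk (degpart (add_principal J f) (d + e)) + dimk (degpart J d) =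
   dimk (degpart J (d + e)) + 'C(d + n, d))%N.
Proof.
have [U hU] := hspace_exists (d + e) hJ.
have [W hW] := hspace_exists d hJ.
pose m : 'Hom(V d, V (d + e)) := linfun (@homog_mul d).
have mE v : val (m v) = val v * f by rewrite lfunE.
have ker0 : lker m == 0%VS.
  apply/lker0P => u v /(congr1 val); rewrite !mE => /(mulIf f0).
  exact: val_inj.
have hadd : forall v, v \in (U + limg m)%VS <-> add_principal J f (val v).
  move=> v; split.
    move=> /memv_addP [u /hU Ju [_ /memv_imgP [w _ ->] ->]].
    by exists (val u), (val w); rewrite -mE.
  move=> [a [b [Ja ev]]].
  have eb : pi (d + e) (b * f) = pi d b * f.
    by rewrite (pihomog_mul _ _ hf) leq_addl addnK.
  pose a' : V (d + e) := DHomog (pihomogP mdeg (d + e) a).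
  pose b' : V d := DHomog (pihomogP mdeg d b).
  have -> : v = a' + m b'.
    apply: val_inj; rewrite /= mE /= -eb -pihomogD -ev pihomog_dE //.
    exact: valP.
  apply: memv_add; last exact/memv_img/memvf.
  by apply/hU/gJ.
have cap : (U :&: limg m)%VS = (m @: W)%VS.
  apply/vspaceP => v; apply/idP/idP.
    rewrite memv_cap => /andP[/hU Jv /memv_imgP [w _ ev]].
    by rewrite ev; apply/memv_img/hW/rf; rewrite mulrC -mE -ev.
  move=> /memv_imgP [w /hW Jw ->]; rewrite memv_cap memv_img ?memvf // andbT.
  by apply/hU; rewrite mE; apply: ideal_mulr.
rewrite (dimk_vspace hadd) (dimk_vspace hU) (dimk_vspace hW).
have := dimv_sum_cap U (limg m); rewrite cap.
rewrite (limg_dim_eq (U := W)); last by rewrite (eqP ker0) capv0.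
rewrite (limg_dim_eq (U := fullv)) ?dim_hom //.
by rewrite (eqP ker0) capv0.
Qed.

Lemma dimk_add_principal_lt d : (d < e)%N ->
  dimk (degpart (add_principal J f) d) = dimk (degpart J d).
Proof.
move=> lt; have [U hU] := hspace_exists d hJ.
rewrite (dimk_vspace hU); apply: dimk_vspace => v; rewrite hU; split.
  exact: add_principal_sub.
move=> [a [b [Ja ev]]]; rewrite -(pihomog_dE (valP v)) ev raddfD /=.
by rewrite (pihomog_mul _ _ hf) leqNgt lt addr0; apply: gJ.
Qed.

End AddPrincipal.

Lemma HF_dimk (J : P -> Prop) d : ideal J ->
  ((HF J d)%:Z = 'C(d + n, d)%:Z - (dimk (degpart J d))%:Z)%R.
Proof.
move=> hJ; rewrite /HF dimk_all subzn //; exact: dimk_le.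
Qed.

(** Additivity on the exact sequence given by multiplication by [f] on the quotient by [J]. It is
    stated over the integers to avoid truncated subtraction. *)
Lemma HF_add_principal (J : P -> Prop) f e d :
  ideal J -> graded J -> f \is e.-homog -> f != 0 ->
  (forall h, J (f * h) -> J h) ->
  (HF (add_principal J f) d)%:Z =
    (HF J d)%:Z - (if (e <= d)%N then (HF J (d - e))%:Z else 0).
Proof.
move=> hJ gJ hf f0 rf; have hJf := add_principal_ideal f hJ.
rewrite !HF_dimk //; case: leqP => [le|lt].
  have := dimk_add_principal hJ gJ hf f0 rf (d - e); rewrite subnK //.
  have := dimk_le d hJ; have := dimk_le d hJf; have := dimk_le (d - e) hJ; lia.
by rewrite (dimk_add_principal_lt hJ gJ hf lt) subr0.
Qed.

End Hilbert.

(** * Hilbert series as integer sequences *)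

Section Sequences.
Implicit Types (u v : nat -> int) (es : seq nat).

(** With a sequence read as a power series in z, [shift j], [delta e] and [psum e] are
    multiplication by z^j, by 1 - z^e and by 1 + z + ... + z^(e-1). *)
Definition shift j u i : int := if (j <= i)%N then u (i - j)%N else 0.
Definition delta e u i : int := u i - shift e u i.
Definition psum e u i : int := \sum_(j < e) shift j u i.

Lemma shift_shift a b u : shift a (shift b u) = shift (a + b) u.
Proof.
apply: functional_extensionality => i; rewrite /shift.
case: (leqP a i) => ai; last by rewrite ifN //; lia.
have -> : (b <= i - a)%N = (a + b <= i)%N by lia.
by rewrite subnDA.
Qed.

(** The geometric sum 1 - z^e = (1 + ... + z^(e-1)) (1 - z), by telescoping. *)
Lemma delta_psum e u : delta e u = psum e (delta 1 u).
Proof.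
apply: functional_extensionality => i; rewrite /psum.
have h j : shift j (delta 1 u) i = shift j u i - shift j.+1 u i.
  have <- : shift j (shift 1 u) i = shift j.+1 u i.
    by rewrite shift_shift addn1.
  by rewrite /delta /shift; case: ifP; rewrite ?subrr.
under eq_bigr => j _ do rewrite h.
elim: e => [|e IH]; first by rewrite big_ord0 /delta /shift subn0 subrr.
by rewrite big_ord_recr /= -IH /delta addrA subrK.
Qed.

Lemma delta_psumC e d u : delta e (psum d u) = psum d (delta e u).
Proof.
apply: functional_extensionality => i; rewrite /delta /psum.
have -> : shift e (fun i => \sum_(j < d) shift j u i) i =
    \sum_(j < d) shift j (shift e u) i.
  under [RHS]eq_bigr => j _ do rewrite shift_shift addnC -shift_shift.
  case: (boolP (e <= i)%N) => e_i.
    rewrite {1}/shift e_i; apply: eq_bigr => j _.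
    by rewrite [RHS]/shift e_i.
  rewrite {1}/shift (negPf e_i) big1 // => j _.
  by rewrite [LHS]/shift (negPf e_i).
rewrite -sumrB; apply: eq_bigr => j _.
by rewrite /shift; case: ifP; rewrite ?subrr.
Qed.

Definition fin_sum u (s : int) := exists M : nat,
  (forall i, (M <= i)%N -> u i = 0) /\ \sum_(i < M) u i = s.

(** The total of a finite sequence is the value of its series at z = 1, where the geometric sum
    takes the value [e]. *)
Lemma psum_fin_sum e u s : fin_sum u s -> fin_sum (psum e u) (e%:Z * s).
Proof.
move=> [M [u0 us]]; exists (M + e)%N; split.
  move=> i lei; rewrite /psum big1 // => j _; rewrite /shift.
  by case: ifP => // _; apply: u0; have := ltn_ord j; lia.
rewrite /psum exchange_big /=.
have h (j : 'I_e) : \sum_(i < M + e) shift j u i = s.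
  have -> : (M + e = j + (M + (e - j)))%N by have := ltn_ord j; lia.
  rewrite big_split_ord /= big1 ?add0r; last first.
    by move=> i _; rewrite /shift leqNgt ltn_ord.
  rewrite big_split_ord /= [X in _ + X]big1 ?addr0.
    by rewrite -us; apply: eq_bigr => i _; rewrite /shift leq_addr addKn.
  by move=> i _; rewrite /shift leq_addr addKn u0 // leq_addr.
by under eq_bigr => j _ do rewrite h; rewrite sumr_const card_ord -mulr_natl natz.
Qed.

(** The coefficients of 1 / (1 - z)^m, the Hilbert series of a polynomial ring in [m] variables. *)
Definition hilb m i : int :=
  if m is m'.+1 then 'C(i + m', i)%:Z else (i == 0%N)%:Z.

Lemma delta_hilb m : delta 1 (hilb m.+1) = hilb m.
Proof.
apply: functional_extensionality => -[|i]; rewrite /delta /shift /=.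
  by case: m => [|m]; rewrite /= !bin0 subr0.
rewrite subn1 /= addSn binS.
case: m => [|m] /=; first by rewrite addn0 bin_small // add0n subrr.
by rewrite -addSnnS addSn PoszD addrK.
Qed.

(** Each factor 1 - z^e cancels one factor 1 - z of the denominator and leaves a geometric sum; with
    as many forms as variables, a polynomial remains. *)
Lemma foldl_delta_hilb es :
  foldl (fun u e => delta e u) (hilb (size es)) es = foldr psum (hilb 0) es.
Proof.
have comm e es' u : foldl (fun u e => delta e u) (psum e u) es' =
    psum e (foldl (fun u e => delta e u) u es').
  by elim: es' u => [|e' es' IH] u //=; rewrite delta_psumC IH.
elim: es => [|e es IH] //=.
by rewrite -[hilb (size es).+1]/(hilb (size es).+1) delta_psum delta_hilb comm IH.
Qed.

Lemma fin_sum_foldr_psum es :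
  fin_sum (foldr psum (hilb 0) es) (\prod_(e <- es) e)%N%:Z.
Proof.
elim: es => [|e es IH] /=.
  rewrite big_nil; exists 1%N; split; first by case.
  by rewrite big_ord1.
by rewrite big_cons PoszM; apply: psum_fin_sum.
Qed.

End Sequences.

Section HilbertCI.
Variables (k : fieldType) (n : nat).
Local Notation P := {mpoly k[n.+1]}.
Implicit Types (J : P -> Prop) (s : seq P).

Lemma HF_gen_over J s es : ideal J -> graded J -> size s = size es ->
  (forall i, (i < size s)%N -> s`_i \is (nth 0%N es i).-homog) -> 0 \notin s ->
  regular_over J s ->
  (fun d => (HF (gen_over J s) d)%:Z) =
    foldl (fun u e => delta e u) (fun d => (HF J d)%:Z) es.
Proof.
elim: s J es => [|f s IH] J [|e es] hJ gJ //= [sz] hs.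
rewrite in_cons negb_or eq_sym => /andP[f0 s0] [rf rs].
have hf : f \is e.-homog := hs 0%N isT.
rewrite (IH _ es) //.
- congr (foldl _ _ es); apply: functional_extensionality => d.
  by rewrite (HF_add_principal d hJ gJ hf f0 rf).
- exact: add_principal_ideal.
- exact: add_principal_graded hf.
- by move=> i; apply: (hs i.+1).
Qed.

Lemma HF_zero d : (HF (fun p : P => p = 0) d)%:Z = hilb n.+1 d.
Proof.
rewrite HF_dimk; last exact: zero_ideal.
suff -> : dimk (degpart (fun p : P => p = 0) d) = 0%N by rewrite subr0.
rewrite (@dimk_vspace _ _ _ _ 0%VS) ?dimv0 // => v; rewrite memv0.
by split=> [/eqP -> //|v0]; apply/eqP/val_inj.
Qed.

Lemma HF_regular_sum s es : size s = n.+1 -> size s = size es ->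
  (forall i, (i < size s)%N -> s`_i \is (nth 0%N es i).-homog) -> 0 \notin s ->
  regular_over (fun p : P => p = 0) s ->
  exists M : nat, (forall i, (M <= i)%N -> HF (gen s) i = 0%N) /\
    (\sum_(i < M) HF (gen s) i = \prod_(e <- es) e)%N.
Proof.
move=> szn sz hs s0 rs.
have := HF_gen_over (@zero_ideal k n.+1) (@zero_graded k n.+1) sz hs s0 rs.
have -> : (fun d => (HF (fun p : P => p = 0) d)%:Z) = hilb (size es).
  by apply: functional_extensionality => d; rewrite HF_zero -szn sz.
rewrite foldl_delta_hilb => e.
have [M [h0 hsum]] := fin_sum_foldr_psum es; exists M.
have h d : (HF (gen s) d)%:Z = foldr psum (hilb 0) es d := congr1 (@^~ d) e.
split=> [i lei|].
  by have := h i; rewrite h0 // => -[].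
apply/eqP; rewrite -eqz_nat -hsum; apply/eqP.
by rewrite -natz natr_sum; apply: eq_bigr => i _; rewrite natz h.
Qed.

Lemma HFsumE J M : (forall i, (M <= i)%N -> HF J i = 0%N) ->
  HFsum J = (\sum_(i < M) HF J i)%N.
Proof.
move=> h; rewrite /HFsum; case: excluded_middle_informative => [ex|[]].
  2: by exists M.
case: constructive_indefinite_description => M' h' /=.
wlog le : M M' h h' / (M <= M')%N => [hw|].
  by case: (leqP M M') => [le|/ltnW le]; [|apply/esym]; apply: hw.
rewrite -(subnKC le) big_split_ord /= [X in (_ + X)%N]big1 ?addn0 // => i _.
by apply: h; rewrite leq_addr.
Qed.

(** A zero entry annihilates 1, so regularity would put 1 into the ideal reached at that stage. *)
Lemma regular_nonzero J s : ideal J -> ~ gen_over J s 1 -> regular_over J s ->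
  0 \notin s.
Proof.
elim: s J => [|f s IH] J hJ //= n1 [rf rs]; rewrite in_cons negb_or eq_sym.
apply/andP; split; last by apply: IH rs => //; apply: add_principal_ideal.
apply/eqP => f0; apply/n1/gen_over_sub/add_principal_sub/rf.
by rewrite f0 mul0r; apply: ideal0.
Qed.

End HilbertCI.

(** * Apolarity and the lower bound *)

Section Apolarity.
Variables (k : fieldType) (N : nat).
Local Notation P := {mpoly k[N]}.
Implicit Types (g F : P) (x : 'I_N -> k).

Definition lform x : P := \sum_i x i *: 'X_i.

Lemma lform_homog x : lform x \is 1.-homog.
Proof. by apply: rpred_sum => i _; apply: rpredZ; rewrite dhomogX; apply/eqP/mdeg1. Qed.

Lemma homog1_lform L : L \is 1.-homog -> L = lform (fun i => L@_U_(i)).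
Proof.
move=> hL; apply/mpolyP => m; rewrite /lform raddf_sum /=.
under eq_bigr => i _ do rewrite mcoeffZ mcoeffX.
case: (altP (mdeg m =P 1%N)) => [/eqP /mdeg1P [j /eqP ->]|ne].
  rewrite (bigD1 j) //= eqxx mulr1 big1 ?addr0 // => i /negPf ne.
  by rewrite eq_mnm1 ne mulr0.
rewrite (dhomog_nemf_coeff hL ne) big1 // => i _.
case: (U_(i)%MM =P m) => [e|_]; last by rewrite mulr0.
by move: ne; rewrite -e mdeg1 eqxx.
Qed.

Lemma mderiv_lform_exp i x D :
  mderiv i (lform x ^+ D) = (D%:R * x i) *: lform x ^+ D.-1.
Proof.
have UU : (U_(i) - U_(i) = 0 :> 'X_{1..N})%MM.
  by apply/mnmP => j; rewrite mnmBE subnn mnm0E.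
have d1 : mderiv i (lform x) = (x i)%:MP.
  rewrite /lform raddf_sum /= (bigD1 i) //= big1 ?addr0 => [|j ne].
    by rewrite mderivZ mderivX mnm1E eqxx scale1r UU mpolyX0 -mul_mpolyC mulr1.
  by rewrite mderivZ mderivX mnm1E (negPf ne) scale0r scaler0.
elim: D => [|D IH]; first by rewrite expr0 mul0r scale0r mderivC.
rewrite exprS mderivM IH d1 mul_mpolyC -scalerAr /= -[D.+1]addn1 natrD mulrDl.
rewrite scalerDl mul1r addrC; congr (_ + _).
by case: D {IH} => [|D]; rewrite ?mul0r ?scale0r // -exprS.
Qed.

(** When [mdeg m] exceeds [D] the truncated exponent does no harm, since the falling factorial is
    then zero. *)
Lemma mderivm_lform_exp m x D :
  mderivm m (lform x ^+ D) =
    ((D ^_ (mdeg m))%:R * ('X_[m]).@[x]) *: lform x ^+ (D - mdeg m).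
Proof.
move: {2}(mdeg m) (erefl (mdeg m)) => d; elim: d m => [|d IH] m.
  move/eqP; rewrite mdeg_eq0 => /eqP ->.
  by rewrite mderivm0m mdeg0 mpolyX0 meval1 mulr1 ffactn0 scale1r subn0.
move=> md; have [i mi] : exists i, (0 < m i)%N.
  apply/existsP; rewrite -[X in is_true X]negbK negb_exists; apply/negP => /forallP h.
  have : mdeg m = 0%N.
    by rewrite mdegE big1 // => i _; apply/eqP; rewrite -leqn0 leqNgt.
  by rewrite md.
have em : m = (m - U_(i) + U_(i))%MM.
  apply/mnmP => j; rewrite mnmDE mnmBE mnm1E.
  by case: eqP => [<-|_]; rewrite ?subnK // subn0 addn0.
set m' := (m - U_(i))%MM in em.
have md' : mdeg m' = d by have := md; rewrite em mdegD mdeg1; lia.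
rewrite em mderivmDm IH // mderivmU1m mderivZ mderiv_lform_exp.
rewrite mdegD mdeg1 md' addn1 scalerA mpolyXD mevalM mevalXU.
rewrite ffactnSr natrM subnS; congr (_ *: _); ring.
Qed.

Lemma apolarwE K g F : (msize g <= K)%N ->
  apolar g F = \sum_(m : 'X_{1..N < K}) g@_m *: mderivm m F.
Proof.
move=> le; rewrite /apolar (big_mksub 'X_{1..N < K}) //=; first last.
- by move=> m /msize_mdeg_lt /leq_trans -> .
- exact: msupp_uniq.
rewrite big_rmcond //= => m; rewrite mcoeff_msupp negbK => /eqP ->.
by rewrite scale0r.
Qed.

Lemma apolar_lform_exp g e x D : g \is e.-homog ->
  apolar g (lform x ^+ D) = ((D ^_ e)%:R * g.@[x]) *: lform x ^+ (D - e).
Proof.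
move=> hg; rewrite /apolar mevalE mulr_sumr scaler_suml /=.
rewrite big_seq [RHS]big_seq; apply: eq_bigr => m ms.
rewrite mderivm_lform_exp (dhomog_mf hg ms) scalerA mevalX.
by congr (_ *: _); ring.
Qed.

Lemma apolar_sum g (I : finType) (f : I -> P) :
  apolar g (\sum_i f i) = \sum_i apolar g (f i).
Proof.
rewrite /apolar exchange_big /=; apply: eq_bigr => m _.
rewrite -scaler_sumr; congr (_ *: _).
exact: (raddf_sum (mderivm m)).
Qed.

Lemma apolar_vanishing g e D r (x : 'I_r -> 'I_N -> k) : g \is e.-homog ->
  (forall j, g.@[x j] = 0) -> apolar g (\sum_j lform (x j) ^+ D) = 0.
Proof.
move=> hg h; rewrite apolar_sum big1 // => j _.
by rewrite (apolar_lform_exp _ _ hg) h mulr0 scale0r.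
Qed.

End Apolarity.

Lemma sum_ord_split (f : nat -> nat) a b : (a <= b)%N ->
  (\sum_(i < b) f i = \sum_(i < a) f i + \sum_(i < b - a) f (a + i))%N.
Proof. by move=> /subnKC; move: (b - a)%N => c <-; rewrite big_split_ord. Qed.

(** * Lower bound from points off the hypersurface of [q] *)

Section LowerBound.
Variables (k : fieldType) (n : nat).
Local Notation P := {mpoly k[n.+1]}.
Local Notation V d := (dhomog n.+1 k d).
Local Notation pi := (pihomog mdeg).
Variables (r : nat) (x : 'I_r -> 'I_n.+1 -> k) (q : P) (e : nat).
Hypothesis hq : q \is e.-homog.

(** The homogeneous ideal of the points off [q = 0]. Testing every homogeneous component makes it
    graded whatever affine representatives [x j] are given. *)
Definition van (p : P) : Prop :=
  forall d j, q.@[x j] != 0 -> (pi d p).@[x j] = 0.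

Lemma van_ideal : ideal van.
Proof.
split=> [d j _|p p' hp hp' d j hj|p p' hp' d j hj].
- by rewrite raddf0 meval0.
- by rewrite raddfD mevalD hp // hp' // addr0.
rewrite (@pihomog_partitionE _ _ mdeg _ p (leqnn _)) mulr_suml.
rewrite (raddf_sum (pihomog mdeg d)) (raddf_sum (meval (x j))).
apply: big1 => l _ /=.
rewrite [_ * p']mulrC (pihomog_mul _ _ (pihomogP mdeg l p)).
by case: ifP => _; rewrite ?meval0 // mevalM hp' // mul0r.
Qed.

Lemma van_graded : graded van.
Proof.
move=> d p hp d' j hj; case: (altP (d =P d')) => [<-|ne].
  by rewrite pihomog_id hp.
by rewrite (pihomog_ne0 ne (pihomogP _ _ _)) meval0.
Qed.

Lemma van_sat h : van (q * h) -> van h.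
Proof.
move=> hv d j hj; have := hv (d + e)%N j hj.
rewrite mulrC (pihomog_mul _ _ hq) leq_addl addnK mevalM => /eqP.
by rewrite mulf_eq0 (negPf hj) orbF => /eqP.
Qed.

Lemma HF_van_le d : (HF van d <= r)%N.
Proof.
(* Evaluation at the points, with the coordinates at points of [q = 0] set to zero; its kernel is
   the degree [d] part of [van], so the quotient embeds in a space of dimension [r]. *)
pose ev (v : V d) : 'rV[k]_r :=
  \row_j (if q.@[x j] != 0 then (val v).@[x j] else 0).
have evl : linear ev.
  move=> a u v; apply/rowP => j; rewrite !mxE.
  have -> : val (a *: u + v) = a *: val u + val v by [].
  by case: ifP => _; rewrite ?mulr0 ?addr0 // mevalD mevalZ.
pose evL := GRing.isLinear.Build _ _ _ _ ev evl.
pose f : {linear V d -> 'rV[k]_r} := HB.pack ev evL.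
have ker v : v \in lker (linfun f) <-> van (val v).
  rewrite memv_ker lfunE /=; split.
    move=> /eqP /rowP h d' j hj; case: (altP (d =P d')) => [<-|ne].
      rewrite pihomog_dE ?(valP v) //.
      by have := h j; rewrite !mxE hj.
    by rewrite (pihomog_ne0 ne (valP v)) meval0.
  move=> h; apply/eqP/rowP => j; rewrite !mxE; case: ifP => // hj.
  by have := h d j hj; rewrite pihomog_dE ?(valP v).
rewrite /HF dimk_all (dimk_vspace ker) -(dim_hom k n d).
rewrite -(limg_ker_dim (linfun f) fullv) capfv addKn.
by apply: leq_trans (dimvS (subvf _)) _; rewrite dimvf /dim /= mul1n.
Qed.

Variable J : P -> Prop.
Hypotheses (hJ : ideal J) (Jq : J q) (q0 : q != 0).
Hypothesis hvan : forall d h, h \is d.-homog -> van h -> J h.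

(** The values of [HF J] are bounded by the differences of [HF van] at distance [e]. Their sum
    telescopes to the last [e] values of [HF van] below [M], each at most [r]. *)
Lemma HF_lower_bound M : (forall i, (M <= i)%N -> HF J i = 0%N) ->
  (\sum_(i < M) HF J i <= e * r)%N.
Proof.
(* For [M < e] the bound at [e] is stronger, since the sum only grows. *)
wlog le : M / (e <= M)%N => [hw h0|h0].
  case: (leqP e M) => [/hw|/ltnW le]; first exact.
  have := hw e (leqnn _) (fun i le' => h0 i (leq_trans le le')).
  by rewrite (sum_ord_split _ le); apply: leq_trans; rewrite leq_addr.
have step i : (HF J i <= HF van i - (if e <= i then HF van (i - e) else 0))%N.
  have hK := van_ideal.
  have : (HF J i <= HF (add_principal van q) i)%N.
    apply: leq_sub2l; apply: dimk_mono => //.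
      exact: add_principal_ideal.
    move=> h hh [a [b [Ka eh]]].
    rewrite -(pihomog_dE hh) eh raddfD /= (pihomog_mul _ _ hq).
    apply: idealD => //.
      by apply: (@hvan i); [apply: pihomogP | apply: van_graded].
    by case: ifP => _; [apply: idealMl | apply: ideal0].
  have := HF_add_principal i hK van_graded hq q0 van_sat.
  by case: ifP => _; lia.
apply: (@leq_trans (\sum_(i < M)
    (HF van i - (if (e <= i)%N then HF van (i - e) else 0)))%N).
  by apply: leq_sum => i _; apply: step.
(* The truncated subtraction is exact: the difference is itself a Hilbert function value, hence
   nonnegative. *)
have eq0 i : (HF van i - (if (e <= i) then HF van (i - e) else 0) +
  (if (e <= i) then HF van (i - e) else 0) = HF van i)%N.
  have := HF_add_principal i van_ideal van_graded hq q0 van_sat.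
  by case: ifP => _; lia.
have : (\sum_(i < M) (HF van i - (if (e <= i) then HF van (i - e) else 0)) +
  \sum_(i < M) (if (e <= i) then HF van (i - e) else 0) =
  \sum_(i < M) HF van i)%N.
  by rewrite -big_split /=; apply: eq_bigr => i _; apply: eq0.
move: (\sum_(i < M) (_ - _))%N => S.
rewrite (sum_ord_split (fun i => if (e <= i)%N then HF van (i - e) else 0%N) le).
rewrite big1 ?add0n; last by move=> i _; rewrite leqNgt ltn_ord.
under eq_bigr => i _ do rewrite leq_addr addKn.
rewrite (sum_ord_split (HF van) (leq_subr e M)) subKn //.
have : (\sum_(i < e) HF van (M - e + i) <= \sum_(i < e) r)%N.
  by apply: leq_sum => i _; apply: HF_van_le.
by rewrite sum_nat_const card_ord => hb; rewrite addnC => /addnI ->.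
Qed.

End LowerBound.

(** * Finite-dimensional quotients and trace forms *)

Lemma mpoly_alg_ind (R : comNzRingType) (N : nat) (Q : {mpoly R[N]} -> Prop) :
  (forall c, Q c%:MP) -> (forall i, Q 'X_i) ->
  (forall p q, Q p -> Q q -> Q (p + q)) ->
  (forall p q, Q p -> Q q -> Q (p * q)) -> forall p, Q p.
Proof.
move=> hC hX hD hM; apply: mpolyind => [|c m p _ _ Qp]; first by rewrite -mpolyC0.
apply: hD => //; rewrite -mul_mpolyC; apply: (hM) => //.
rewrite mpolyXE_id; apply: (big_ind Q) => [|//|i _].
  by rewrite -[1]/(1%:MP).
elim: (m i) => [|d IH]; first by rewrite expr0 -[1]/(1%:MP).
by rewrite exprS; apply: (hM).
Qed.

Section Nonvanishing.

Lemma digits_inj B N (f g : 'I_N -> nat) :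
  (forall i, f i < B)%N -> (forall i, g i < B)%N ->
  (\sum_i f i * B ^ i = \sum_i g i * B ^ i)%N -> f =1 g.
Proof.
elim: N f g => [|N IH] f g hf hg; first by move=> _ [].
rewrite !big_ord_recl !expn0 !muln1.
have E (h : 'I_N.+1 -> nat) :
    (\sum_(i < N) h (lift ord0 i) * B ^ (lift ord0 i) =
     (\sum_(i < N) h (lift ord0 i) * B ^ i) * B)%N.
  by rewrite big_distrl; apply: eq_bigr => i _; rewrite lift0 expnSr mulnA.
rewrite !E => e.
have B0 : (0 < B)%N by apply: leq_ltn_trans (hf ord0).
have e0 : f ord0 = g ord0.
  by have := congr1 (modn^~ B) e; rewrite /= ![(_ + _ * B)%N]addnC !modnMDl !modn_small.
have e1 : (\sum_(i < N) f (lift ord0 i) * B ^ i =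
           \sum_(i < N) g (lift ord0 i) * B ^ i)%N.
  by move: e; rewrite e0 => /addnI /eqP; rewrite eqn_pmul2r // => /eqP.
move=> i; case: (unliftP ord0 i) => [j|] ->; last exact: e0.
exact: (IH (fun i => f (lift ord0 i)) (fun i => g (lift ord0 i))).
Qed.

(* Kronecker substitution [X_i := z ^ (B ^ i)], which is injective on the
   monomials with exponents below [B]. *)
Lemma mpoly_nonvanishing (k : closedFieldType) (N : nat) (p : {mpoly k[N]}) :
  p != 0 -> exists x : 'I_N -> k, p.@[x] != 0.
Proof.
move=> p0; pose B := (msize p).+1.
pose w (m : 'X_{1..N}) := (\sum_i m i * B ^ i)%N.
have ltB m : m \in msupp p -> forall i, (m i < B)%N.
  move=> ms i; apply: (@leq_ltn_trans (mdeg m)); last by rewrite /B ltnS ltnW ?msize_mdeg_lt.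
  by rewrite mdegE (bigD1 i) //= leq_addr.
pose f : {poly k} := \sum_(m <- msupp p) p@_m *: 'X^(w m).
have f0 : f != 0.
  have ms := mlead_supp p0; apply/eqP => /polyP /(_ (w (mlead p))) /eqP.
  rewrite coef0 coef_sum (bigD1_seq (mlead p)) ?msupp_uniq //= coefZ coefXn eqxx.
  rewrite mulr1 big_seq_cond big1 ?addr0 ?(negPf _) // => [|m /andP[ms' ne]].
    by rewrite mleadc_eq0 (negPf p0).
  rewrite coefZ coefXn; case: eqP => [e|_]; last by rewrite mulr0.
  case/eqP: ne; apply/mnmP; apply: (digits_inj (ltB _ ms') (ltB _ ms)).
  exact: esym e.
have [z hz] := closed_nonrootP _ f0.
exists (fun i => z ^+ (B ^ i)); apply: contra hz => /eqP e.
rewrite rootE -e /f horner_sum mevalE; apply/eqP/eq_bigr => m _.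
rewrite hornerZ hornerXn; congr (_ * _).
by rewrite -prodrXr; apply: eq_bigr => i _; rewrite -exprM mulnC.
Qed.

Lemma mpoly_vanishing (k : closedFieldType) (N : nat) (p : {mpoly k[N]}) :
  (forall x, p.@[x] = 0) -> p = 0.
Proof.
by move=> h; apply/eqP/negPn/negP => /mpoly_nonvanishing [x]; rewrite h eqxx.
Qed.

End Nonvanishing.

(** * Traces and nilpotency of matrices *)

Section Traces.
Variables (k : closedFieldType) (N : nat).
Implicit Types M E : 'M[k]_N.+1.

(** In a full-rank factorisation [E = C *m R] idempotency forces [R *m C = 1%:M], and the trace is
    invariant under exchanging the factors. *)
Lemma idempotent_trace E : E * E = E -> \tr E = (\rank E)%:R.
Proof.
move=> idE; move: (col_base_full E) (row_base_free E) (mulmx_base E).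
move: (col_base E) (row_base E) => C R fC fR eE.
have -> : \tr E = \tr (R *m C) by rewrite -mxtrace_mulC eE.
suff -> : R *m C = 1%:M by rewrite mxtrace1.
apply: (row_full_inj fC); apply: (row_free_inj fR).
by rewrite mulmx1 mulmxA -[_ *m C *m R]mulmxA eE; apply: idE.
Qed.

(** All eigenvalues are zero, so the characteristic polynomial is a power of ['X] and its subleading
    coefficient vanishes. *)
Lemma nilpotent_trace M s : M ^+ s = 0 -> \tr M = 0.
Proof.
move=> nil.
have [rs e] := closed_field_poly_normal (char_poly M).
move: e; rewrite (monicP (char_poly_monic M)) scale1r => e.
have z0 z : z \in rs -> z = 0.
  move=> zr; have : root (char_poly M) z by rewrite e root_prod_XsubC.
  rewrite -eigenvalue_root_char => /eigenvalueP [v Mv v0].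
  have : v *m (M ^+ s) = z ^+ s *: v.
    elim: (s) => [|i IH]; first by rewrite !expr0 scale1r mulmx1.
    by rewrite exprSr mulmxA IH -scalemxAl Mv scalerA -exprSr.
  rewrite nil mulmx0 => /esym/eqP; rewrite scaler_eq0 (negPf v0) orbF.
  by rewrite expf_eq0 => /andP[_ /eqP].
have eX : char_poly M = 'X^(size rs).
  rewrite e (eq_big_seq (fun=> 'X)) ?big_const_seq ?count_predT ?iter_mulr_1 //.
  by move=> z zr; rewrite (z0 z zr) subr0.
have sz : size rs = N.+1.
  by have := size_char_poly M; rewrite eX size_polyXn => -[].
have := char_poly_trace M (ltn0Sn N).
rewrite eX sz coefXn /= ltn_eqF // => /esym/eqP.
by rewrite oppr_eq0 => /eqP.
Qed.

(** The projector [E] onto the part where [M] is invertible is a polynomial in [M] without constant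
    term, so its trace is zero. In characteristic zero its rank is then zero, and [M] is
    nilpotent. *)
Lemma nilpotent_of_traces M : [pchar k] =i pred0 ->
  (forall m, \tr (M ^+ m.+1) = 0) -> exists s, M ^+ s = 0.
Proof.
move=> /pcharf0P char0 trM.
have [s [q q0 eq]] := multiplicity_XsubC (char_poly M) 0.
rewrite monic_neq0 ?char_poly_monic //= subr0 in q0 eq; exists s.
(* The exponent [s.+1] rather than [s] keeps [E] free of a constant term even when [s = 0]; the
   hypothesis covers positive powers of [M] only. *)
have : coprimep q ('X ^+ s.+1).
  by rewrite coprimep_expr // -['X]subr0 coprimep_XsubC.
move=> /Bezout_eq1_coprimepP [[u v] /= uv].
have CH w : horner_mx M (w * char_poly M) = 0.
  by rewrite rmorphM /= Cayley_Hamilton mulr0.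
pose E := horner_mx M (v * 'X ^+ s.+1).
have idE : E * E = E.
  apply/eqP; rewrite -subr_eq0 -rmorphM -rmorphB /=; apply/eqP.
  have -> : v * 'X ^+ s.+1 * (v * 'X ^+ s.+1) - v * 'X ^+ s.+1 =
      - (u * v * 'X) * char_poly M.
    rewrite eq -[X in _ - X]mulr1 -uv exprS; ring.
  exact: CH.
have trE : \tr E = 0.
  rewrite /E exprSr mulrA -[v * _]coefK poly_def mulr_suml !raddf_sum /=.
  apply: big1 => i _; rewrite -scalerAl -exprSr linearZ /= rmorphXn /=.
  by rewrite horner_mx_X linearZ /= trM mulr0.
have : (\rank E)%:R == 0 :> k by rewrite -idempotent_trace // trE.
rewrite char0 mxrank_eq0 => /eqP E0.
have <- : horner_mx M ('X ^+ s) = M ^+ s by rewrite rmorphXn /= horner_mx_X.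
rewrite -[_ ^+ s]mulr1 -uv mulrDr rmorphD /= [X in _ + X]rmorphM /= -/E E0.
rewrite mulr0 addr0; have -> : 'X^s * (u * q) = u * char_poly M by rewrite eq; ring.
exact: CH.
Qed.

End Traces.

(** * Zeros and trace form of a finite-dimensional quotient *)

Section QuotientAlgebra.
Variables (k : closedFieldType) (n N : nat).
Local Notation P := {mpoly k[n]}.
Variables (I : P -> Prop) (b : 'I_N.+1 -> P).
Hypothesis hI : ideal I.
Hypothesis span_b : forall p, exists v : 'I_N.+1 -> k, I (p - \sum_j v j *: b j).
Hypothesis free_b : forall v : 'I_N.+1 -> k, I (\sum_j v j *: b j) ->
  forall j, v j = 0.

Definition lincomb (v : 'rV[k]_N.+1) : P := \sum_j v 0 j *: b j.

Fact lincomb_is_linear : linear lincomb.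
Proof.
move=> a u v; rewrite /lincomb scaler_sumr -big_split /=.
by apply: eq_bigr => j _; rewrite !mxE scalerDl scalerA.
Qed.

HB.instance Definition _ := GRing.isLinear.Build k 'rV[k]_N.+1 P _
  lincomb lincomb_is_linear.

Lemma coord_exists p : exists v : 'rV[k]_N.+1, I (p - lincomb v).
Proof.
have [v hv] := span_b p; exists (\row_j v j).
by rewrite /lincomb; under eq_bigr => j _ do rewrite mxE.
Qed.

Definition coords p := proj1_sig (constructive_indefinite_description _ (coord_exists p)).

Lemma coordsP p : I (p - lincomb (coords p)).
Proof.
exact: (proj2_sig (constructive_indefinite_description _ (coord_exists p))).
Qed.

Lemma coords_uniq p v : I (p - lincomb v) -> coords p = v.
Proof.
move=> h; apply/eqP; rewrite -subr_eq0; apply/eqP/rowP => j; rewrite [RHS]mxE.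
apply: (@free_b (fun j => (coords p - v) 0 j) _ j).
change (I (lincomb (coords p - v))); rewrite linearB /=.
have -> : lincomb (coords p) - lincomb v =
  (p - lincomb v) - (p - lincomb (coords p)) by ring.
by apply: idealB => //; apply: coordsP.
Qed.

Fact coords_is_linear : linear coords.
Proof.
move=> a p q; apply: coords_uniq; rewrite linearP /=.
have -> : a *: p + q - (a *: lincomb (coords p) + lincomb (coords q)) =
   a *: (p - lincomb (coords p)) + (q - lincomb (coords q)).
  by rewrite scalerBr opprD addrACA.
by apply: idealD => //; [apply: idealZ |]; rewrite //; apply: coordsP.
Qed.

HB.instance Definition _ := GRing.isLinear.Build k P 'rV[k]_N.+1 _
  coords coords_is_linear.

Lemma coords_eq0 p : coords p = 0 <-> I p.
Proof.
split=> [e|Ip]; last by apply: coords_uniq; rewrite linear0 subr0.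
by have := coordsP p; rewrite e linear0 subr0.
Qed.

Definition mulmat p : 'M[k]_N.+1 := \matrix_i coords (p * b i).

Lemma coords_mul p s : coords (s * p) = coords s *m mulmat p.
Proof.
apply/eqP; rewrite -subr_eq0; apply/eqP.
have -> : coords s *m mulmat p = coords (p * lincomb (coords s)).
  rewrite mulmx_sum_row /lincomb mulr_sumr linear_sum /=.
  by apply: eq_bigr => i _; rewrite rowK -scalerAr linearZ.
rewrite -linearB /=; apply/coords_eq0.
by rewrite mulrC -mulrBr; apply: idealMl => //; apply: coordsP.
Qed.

Lemma mulmatM p s : mulmat (p * s) = mulmat p *m mulmat s.
Proof.
by apply/row_matrixP => i; rewrite row_mul !rowK -coords_mul mulrAC.
Qed.

Fact mulmat_is_linear : linear mulmat.
Proof.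
move=> a p q; apply/row_matrixP => i.
by rewrite linearP /= !rowK mulrDl -scalerAl linearP.
Qed.

HB.instance Definition _ := GRing.isLinear.Build k P 'M[k]_N.+1 _
  mulmat mulmat_is_linear.

Lemma mulmat_eq0 p : mulmat p = 0 <-> I p.
Proof.
split=> [e|Ip].
  by apply/coords_eq0; rewrite -[p]mul1r coords_mul e mulmx0.
apply/row_matrixP => i; rewrite rowK row0; apply/coords_eq0.
exact: ideal_mulr.
Qed.

Lemma mulmat1 : mulmat 1 = 1%:M.
Proof.
apply/row_matrixP => i; rewrite rowK mul1r rowE mulmx1; apply: coords_uniq.
rewrite /lincomb (bigD1 i) //= mxE !eqxx scale1r big1 ?addr0 ?subrr //.
  exact: ideal0.
by move=> j ne; rewrite mxE (negPf ne) andbF scale0r.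
Qed.

Lemma mulmatX p m : mulmat (p ^+ m) = mulmat p ^+ m.
Proof.
elim: m => [|m IH]; first by rewrite !expr0 mulmat1.
by rewrite !exprS mulmatM IH.
Qed.

Lemma mulmat_congr p q : I (p - q) -> mulmat p = mulmat q.
Proof.
by move=> h; apply/eqP; rewrite -subr_eq0 -linearB /=; apply/eqP/mulmat_eq0.
Qed.

(** Cayley-Hamilton for multiplication by [p], with the characteristic polynomial split into linear
    factors. *)
Lemma annihilating_roots p : exists rs : seq k, I (\prod_(z <- rs) (p - z%:MP)).
Proof.
have [rs e] := closed_field_poly_normal (char_poly (mulmat p)).
exists rs; apply/mulmat_eq0.
have : horner_mx (mulmat p) (char_poly (mulmat p)) = 0 := Cayley_Hamilton _.
rewrite e (monicP (char_poly_monic _)) scale1r => <-.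
elim: rs {e} => [|z rs IH]; first by rewrite !big_nil mulmat1 [RHS]rmorph1.
rewrite !big_cons mulmatM IH rmorphM /= rmorphB /= horner_mx_X horner_mx_C.
by rewrite linearB /= -[z%:MP]mulr1 mul_mpolyC linearZ /= mulmat1 scalemx1.
Qed.

(** Multiply [s] by the factors one after the other: the last product that is still nonzero is an
    eigenvector for the factor that kills it. *)
Lemma eigen_step p s rs : ~ I s -> I (s * \prod_(z <- rs) (p - z%:MP)) ->
  exists2 z, z \in rs & exists s', ~ I (s * s') /\ I ((p - z%:MP) * (s * s')).
Proof.
elim: rs s => [|z rs IH] s ns; first by rewrite big_nil mulr1.
rewrite big_cons mulrA => Is.
have [Isz|nsz] := excluded_middle_informative (I (s * (p - z%:MP))).
  exists z; first exact: mem_head.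
  by exists 1; rewrite mulr1 mulrC.
have [z' z'rs [s' [ns' Is']]] := IH _ nsz Is.
exists z'; first by rewrite in_cons z'rs orbT.
by exists ((p - z%:MP) * s'); rewrite !mulrA in ns' Is' *.
Qed.

(** Eigenvectors are taken for one variable after another, each a multiple of the previous one, so
    the earlier eigenvalue relations persist. The eigenvalues are the coordinates of [x], and every
    polynomial then acts by its value at [x]. *)
Lemma common_eigenvector s : ~ I s ->
  exists x : 'I_n -> k, exists s', ~ I (s * s') /\
    forall h, I ((h - (h.@[x])%:MP) * (s * s')).
Proof.
move=> ns.
suff [x [s' [ns' hs']]] : exists x : 'I_n -> k, exists s', ~ I (s * s') /\
    forall i, I (('X_i - (x i)%:MP) * (s * s')).
  exists x, s'; split=> //; apply: mpoly_alg_ind => [c|i|p q hp hq|p q hp hq].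
  - by rewrite mevalC subrr mul0r; apply: ideal0.
  - by rewrite mevalXU.
  - by rewrite mevalD mpolyCD opprD addrACA mulrDl; apply: idealD.
  rewrite mevalM mpolyCM.
  have -> : (p * q - p.@[x]%:MP * q.@[x]%:MP) * (s * s') =
    p * ((q - q.@[x]%:MP) * (s * s')) + q.@[x]%:MP * ((p - p.@[x]%:MP) * (s * s')).
    by ring.
  by apply: idealD => //; apply: idealMl.
suff H m : exists x : 'I_n -> k, exists s', ~ I (s * s') /\
    forall i : 'I_n, (i < m)%N -> I (('X_i - (x i)%:MP) * (s * s')).
  by have [x [s' [ns' h]]] := H n; exists x, s'; split=> // i; apply: h.
elim: m => [|m [x [s' [ns' h]]]].
  by exists (fun=> 0), 1; rewrite mulr1.
case: (ltnP m n) => [lt|le]; last first.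
  exists x, s'; split=> // i _; apply: h.
  by apply: leq_trans le; apply: ltn_ord.
pose i := Ordinal lt; have [rs hrs] := annihilating_roots 'X_i.
have [z _ [s2 [ns2 Is2]]] := eigen_step ns' (@idealMl _ _ _ hI (s * s') _ hrs).
exists (fun j => if j == i then z else x j), (s' * s2).
rewrite !mulrA in ns2 Is2 *; split=> // j.
rewrite ltnS leq_eqVlt => /orP[/eqP e|lj].
  have -> : j = i by apply: val_inj.
  by rewrite eqxx; move: Is2; rewrite !mulrA.
rewrite ifN; last by apply: contraTneq lj => ->; rewrite ltnn.
have -> : ('X_j - (x j)%:MP) * (s * s' * s2) =
  ('X_j - (x j)%:MP) * (s * s') * s2 by ring.
by apply: ideal_mulr => //; apply: h.
Qed.

Definition zero_of (x : 'I_n -> k) := forall h, I h -> h.@[x] = 0.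

(** A Nullstellensatz by eigenvectors. If no power of [p] is in [I], then [p] has a nonzero
    eigenvalue; a common eigenvector inside that eigenspace yields a zero of [I] at which [p] takes
    this value. *)
Lemma vanishing_nilpotent p : (forall x, zero_of x -> p.@[x] = 0) ->
  exists s, I (p ^+ s).
Proof.
move=> hp; apply: NNPP => nil.
have {}nil s : ~ I (p ^+ s) by move=> h; apply: nil; exists s.
have [rs hrs] := annihilating_roots p.
(* The zero roots are split off into the power [p ^+ m], which is not in [I], so that [eigen_step]
   can only return a nonzero root. *)
pose m := count_mem 0 rs; pose rs0 := [seq z <- rs | z != 0].
have e : \prod_(z <- rs) (p - z%:MP) = p ^+ m * \prod_(z <- rs0) (p - z%:MP).
  rewrite (bigID (fun z => z == 0)) /= big_filter; congr (_ * _).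
  rewrite (eq_bigr (fun=> p)); last by move=> z /eqP ->; rewrite mpolyC0 subr0.
  by rewrite big_const_seq iter_mulr_1.
rewrite e in hrs; have [z zrs [s' [ns' Is']]] := eigen_step (nil m) hrs.
have [x [s2 [ns2 h]]] := common_eigenvector ns'.
have cst c : I (c%:MP * (p ^+ m * s' * s2)) -> c = 0.
  move=> Ic; apply/eqP/negPn/negP => c0; apply: ns2.
  have := idealZ c^-1 hI Ic.
  by rewrite mul_mpolyC scalerA mulVf // scale1r.
have hx : zero_of x.
  move=> g Ig; apply: cst; apply: (ideal_sub_trans hI _ (ideal_mulr (p ^+ m * s' * s2) hI Ig)).
  rewrite -mulrBl -opprB mulNr; exact: idealN (h g).
have z0 : z = 0.
  apply: cst; apply: (ideal_sub_trans hI (q := p * (p ^+ m * s' * s2))).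
    rewrite -mulrBl -opprB mulNr; apply: idealN => //.
    by rewrite [_ * s2]mulrC mulrCA; apply: idealMl.
  by have := h p; rewrite hp // mpolyC0 subr0.
by move: zrs; rewrite mem_filter z0 eqxx.
Qed.

Lemma nilpotent_tr p s : I (p ^+ s) -> \tr (mulmat p) = 0.
Proof. by move/mulmat_eq0; rewrite mulmatX; apply: nilpotent_trace. Qed.

(** By linearity [p * g] has trace zero for every [g], in particular every positive power of [p]
    does. *)
Lemma tr_vanishing p : [pchar k] =i pred0 ->
  (forall j, \tr (mulmat (p * b j)) = 0) -> exists s, I (p ^+ s).
Proof.
move=> char0 h.
have {}h g : \tr (mulmat (p * g)) = 0.
  rewrite (mulmat_congr (q := p * lincomb (coords g))); last first.
    by rewrite -mulrBr; apply: idealMl => //; apply: coordsP.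
  rewrite /lincomb mulr_sumr !linear_sum /= big1 // => i _.
  by rewrite -scalerAr !linearZ /= h mulr0.
have [m|s hs] := nilpotent_of_traces (M := mulmat p) char0.
  by rewrite -mulmatX exprS h.
by exists s; apply/mulmat_eq0; rewrite mulmatX.
Qed.

Definition gram : 'M[k]_N.+1 := \matrix_(i, j) \tr (mulmat (b i * b j)).

Lemma tr_lincomb v j : \tr (mulmat (lincomb v * b j)) = (v *m gram) 0 j.
Proof.
rewrite /lincomb mulr_suml !linear_sum mxE /=; apply: eq_bigr => i _.
by rewrite -scalerAl !linearZ /= mxE.
Qed.

(** A nondegenerate trace form makes the quotient reduced: a vanishing [p] is nilpotent, so are its
    multiples, and their traces being zero puts the coordinates of [p] in the kernel of [gram]. *)
Lemma gram_radical p : \det gram != 0 ->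
  (forall x, zero_of x -> p.@[x] = 0) -> I p.
Proof.
move=> dg hp; have [s hs] := vanishing_nilpotent hp.
apply/coords_eq0.
have ug : gram \in unitmx by rewrite unitmxE unitfE.
apply: (can_inj (mulmxK ug)); rewrite mul0mx; apply/rowP => j.
rewrite [RHS]mxE -tr_lincomb.
rewrite -(mulmat_congr (p := p * b j)); last first.
  by rewrite -mulrBl; apply: ideal_mulr => //; apply: coordsP.
by apply: (@nilpotent_tr _ s); rewrite exprMn; apply: ideal_mulr.
Qed.

(** The products [L j] are nonzero at [y j] and zero at the other points, so they are independent
    modulo [I], as in Lagrange interpolation. *)
Lemma card_zeros r (y : 'I_r -> 'I_n -> k) : (forall j, zero_of (y j)) ->
  (forall j j', j != j' -> exists i, y j i != y j' i) -> (r <= N.+1)%N.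
Proof.
move=> zy dy.
pose fac j j' : P :=
  if [pick i | y j i != y j' i] is Some i then 'X_i - (y j' i)%:MP else 1.
have fac1 j j' : (fac j j').@[y j] != 0.
  rewrite /fac; case: pickP => [i h|_]; last by rewrite meval1 oner_neq0.
  by rewrite mevalB mevalXU mevalC subr_eq0.
have fac0 j j' : j != j' -> (fac j j').@[y j'] = 0.
  move=> /dy [i0 h0]; rewrite /fac; case: pickP => [i _|/(_ i0)].
    by rewrite mevalB mevalXU mevalC subrr.
  by rewrite h0.
pose L j := \prod_(j' | j' != j) fac j j'.
have Lj j : (L j).@[y j] != 0.
  by rewrite rmorph_prod; apply/prodf_neq0 => j' _; apply: fac1.
have Lj' j j' : j' != j -> (L j).@[y j'] = 0.
  move=> ne; rewrite rmorph_prod (bigD1 j') //= fac0 ?mul0r //.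
  by rewrite eq_sym.
pose C : 'M[k]_(r, N.+1) := \matrix_j coords (L j).
suff : row_free C by rewrite /row_free => /eqP <-; apply: rank_leq_col.
rewrite -kermx_eq0; apply/eqP/row_matrixP => i; rewrite row0.
have : row i (kermx C) *m C = 0 by rewrite -row_mul mulmx_ker row0.
move: (row i _) => v vC; apply/rowP => j; rewrite [RHS]mxE.
have : I (\sum_j v 0 j *: L j).
  apply/coords_eq0; rewrite linear_sum /= -[RHS]vC mulmx_sum_row.
  by apply: eq_bigr => l _; rewrite linearZ rowK.
move/(zy j); rewrite rmorph_sum (bigD1 j) //= big1 ?addr0.
  by rewrite mevalZ => /eqP; rewrite mulf_eq0 (negPf (Lj j)) orbF => /eqP.
by move=> l ne; rewrite mevalZ Lj' ?mulr0 // eq_sym.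
Qed.

End QuotientAlgebra.

(** * Deforming a complete intersection to a reduced one *)

Section InitialForms.
Variables (k : fieldType) (N : nat).
Local Notation P := {mpoly k[N]}.
Local Notation pi := (pihomog mdeg).
Implicit Types (p f x : P) (s : seq (P * P * nat)).

Lemma mcoeff_pihomog d p m : (pi d p)@_m = if mdeg m == d then p@_m else 0.
Proof.
rewrite {1}[p]mpolyE [p in RHS]mpolyE.
elim: (msupp p) => [|m' r IH]; first by rewrite !big_nil raddf0 mcoeff0 if_same.
rewrite !big_cons raddfD !mcoeffD /= IH linearZ /= !mcoeffZ pihomogX mcoeffX.
case: (m' =P m) => [->|ne].
  by case: ifP => _; rewrite ?mcoeffX ?eqxx // mcoeff0 mulr0 addr0.
rewrite mulr0 add0r; case: (mdeg m' == d); rewrite ?mcoeffX ?mcoeff0 ?mulr0 ?add0r //.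
by move/eqP/negPf: ne => ->; rewrite mulr0 add0r.
Qed.

Lemma msize_leP p d : reflect (forall m, (d <= mdeg m)%N -> p@_m = 0) (msize p <= d)%N.
Proof.
apply: (iffP idP) => [le m dm|h].
  by apply/eqP; rewrite mcoeff_eq0; apply/msize_mdeg_ge/(leq_trans le).
rewrite msizeE; apply/bigmax_leqP_seq => m ms _; rewrite ltnNge; apply/negP => le.
by move: ms; rewrite mcoeff_msupp h ?eqxx.
Qed.

Lemma msize_homog p d : p \is d.-homog -> (msize p <= d.+1)%N.
Proof.
by move=> hp; apply/msize_leP => m dm; apply: (dhomog_nemf_coeff hp); rewrite gtn_eqF.
Qed.

Lemma pihomog_msize p d : (msize p <= d)%N -> pi d p = 0.
Proof.
move=> /msize_leP h; apply/mpolyP => m; rewrite mcoeff_pihomog mcoeff0.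
by case: eqP => // e; rewrite h ?e.
Qed.

Lemma msize_drop p d : (msize p <= d.+1)%N -> pi d p = 0 -> (msize p <= d)%N.
Proof.
move=> /msize_leP h /mpolyP p0; apply/msize_leP => m.
rewrite leq_eqVlt => /orP[/eqP e|]; last exact: h.
by have := p0 m; rewrite mcoeff_pihomog mcoeff0 e eqxx.
Qed.

Lemma msize_mul_le p q : (msize (p * q) <= (msize p + msize q).-1)%N.
Proof.
have [->|p0] := eqVneq p 0; first by rewrite mul0r msize0.
have [->|q0] := eqVneq q 0; first by rewrite mulr0 msize0.
by rewrite msizeM.
Qed.

(** The triple is [(f, x, e)]. As [msize] is the degree plus one, the bound says that [f - x] has
    degree below [e]: the form [x] is the degree [e] part of [f]. *)
Definition perturbation (t : P * P * nat) :=
  t.1.2 \is (t.2).-homog /\ (msize (t.1.1 - t.1.2)%R <= t.2)%N.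

Lemma perturbation_mul t b D : perturbation t -> (msize b <= D.+1)%N ->
  (msize (b * t.1.1) <= (D + t.2).+1)%N /\ pi (D + t.2) (b * t.1.1) = pi D b * t.1.2.
Proof.
case: t => [[f x] e] [/= hx hfx] hb.
have -> : b * f = b * x + b * (f - x) by ring.
have h1 : (msize (b * x) <= (D + e).+1)%N.
  by apply: leq_trans (msize_mul_le _ _) _; have := msize_homog hx; lia.
have h2 : (msize (b * (f - x)) <= D + e)%N.
  by apply: leq_trans (msize_mul_le _ _) _; lia.
split.
  apply: leq_trans (msizeD_le _ _) _; rewrite geq_max h1.
  exact: leq_trans h2 _.
by rewrite raddfD /= (pihomog_msize h2) addr0 (pihomog_mul _ _ hx) leq_addl addnK.
Qed.

Notation fgens s := [seq t.1.1 | t <- s].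
Notation xgens s := [seq t.1.2 | t <- s].

Lemma gen_rcons (fs : seq P) f : gen (rcons fs f) = add_principal (gen fs) f.
Proof. by rewrite /gen_over foldl_rcons. Qed.

Lemma gen_ideal (fs : seq P) : ideal (gen fs).
Proof. exact/gen_over_ideal/zero_ideal. Qed.

(** In a homogeneous expression of [u] each [x] is replaced by its perturbation [f], which only adds
    terms of degree below [d]. *)
Lemma lift_initial_form s d u : (forall t, t \in s -> perturbation t) ->
  u \is d.-homog -> gen (xgens s) u ->
  exists w, [/\ gen (fgens s) w, (msize w <= d.+1)%N & pi d w = u].
Proof.
elim/last_ind: s u => [|s t IH] u hs hu; first by move=> /= ->; exists 0; rewrite msize0 raddf0.
have ht : perturbation t by apply: hs; rewrite mem_rcons mem_head.
have hs' t' : t' \in s -> perturbation t'.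
  by move=> h; apply: hs; rewrite mem_rcons in_cons h orbT.
rewrite !map_rcons !gen_rcons => -[u' [v [gu' eu]]].
have xg : {in xgens s, forall f, exists e, f \is e.-homog}.
  by move=> _ /mapP [t' /hs' [ht' _] ->]; exists t'.2.
have gg := gen_over_graded (@zero_ideal k N) (@zero_graded k N) xg.
have [w' [gw' sw' ew']] := IH (pi d u') hs' (pihomogP _ _ _) (gg d _ gu').
have eu2 : u = pi d u' + (if (t.2 <= d)%N then pi (d - t.2) v * t.1.2 else 0).
  by rewrite -(pihomog_mul _ _ ht.1) -raddfD /= -eu pihomog_dE.
move: eu2; case: leqP => [le|lt] eu2; last first.
  exists w'; rewrite eu2 addr0; split=> //; exact: add_principal_sub.
have [s1 s2] := perturbation_mul ht (msize_homog (pihomogP mdeg (d - t.2) v)).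
rewrite subnK // pihomog_id in s1 s2.
exists (w' + pi (d - t.2) v * t.1.1); split.
- by exists w', (pi (d - t.2) v).
- by apply: leq_trans (msizeD_le _ _) _; rewrite geq_max sw'.
- by rewrite raddfD /= ew' s2.
Qed.

(* A cancellation of leading terms in [p' + u * f] is absorbed by regularity,
   which lowers the degree of [u]. *)
Lemma initial_form s m p : (forall t, t \in s -> perturbation t) ->
  regular_over (fun p => p = 0) (xgens s) ->
  gen (fgens s) p -> (msize p <= m.+1)%N -> gen (xgens s) (pi m p).
Proof.
elim/last_ind: s m p => [|s t IH] m p hs; first by move=> _ /= ->; rewrite raddf0.
have ht : perturbation t by apply: hs; rewrite mem_rcons mem_head.
have hs' t' : t' \in s -> perturbation t'.
  by move=> h; apply: hs; rewrite mem_rcons in_cons h orbT.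
rewrite !map_rcons !gen_rcons -cats1 => /regular_over_cat [rs [rt _]].
move=> [p' [u [gp' ep]]] sp.
have [D hD] : exists D, (msize u <= D)%N by exists (msize u).
elim: D u p' gp' ep hD => [|D IHD] u p' gp' ep hD.
  move: hD; rewrite leqn0 msize_poly_eq0 => /eqP u0.
  by apply: add_principal_sub; apply: IH => //; rewrite ep u0 mul0r addr0.
have [s1 s2] := perturbation_mul ht hD.
have ep' : p' = p - u * t.1.1 by rewrite ep addrK.
case: (leqP (D + t.2) m) => [le|lt].
  have sp' : (msize p' <= m.+1)%N.
    rewrite ep'; apply: leq_trans (msizeD_le _ _) _; rewrite msizeN geq_max sp.
    exact: leq_trans s1 _.
  rewrite ep raddfD /=; apply: idealD.
  - exact/add_principal_ideal/gen_ideal.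
  - by apply: add_principal_sub; apply: IH.
  have hD' : (msize u <= (m - t.2).+1)%N by lia.
  have [_ ] := perturbation_mul ht hD'; rewrite subnK; last by lia.
  by move=> ->; apply: add_principal_mul; apply: gen_ideal.
have sp' : (msize p' <= (D + t.2).+1)%N.
  rewrite ep'; apply: leq_trans (msizeD_le _ _) _; rewrite msizeN geq_max s1 andbT.
  by apply: leq_trans sp _; lia.
have := IH _ _ hs' rs gp' sp'.
rewrite ep' raddfB /= s2 (pihomog_msize (leq_trans sp lt)) sub0r.
move/(idealN (gen_ideal _)); rewrite opprK mulrC => /rt gu.
(* The leading form of [u] lies in the ideal of the earlier forms; subtracting a lift [w] lowers the
   degree of [u], and [w * f] is absorbed into [p']. *)
have [w [gw sw ew]] := lift_initial_form hs' (pihomogP _ _ _) gu.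
apply: (IHD (u - w) (p' + w * t.1.1)).
- by apply: idealD => //; [apply: gen_ideal | apply: ideal_mulr => //; apply: gen_ideal].
- by rewrite ep; ring.
apply: msize_drop; last by rewrite raddfB /= ew subrr.
by apply: leq_trans (msizeD_le _ _) _; rewrite msizeN geq_max hD.
Qed.

End InitialForms.

Lemma gen_codomP (k : fieldType) (N r : nat) (x : 'I_r -> {mpoly k[N]}) p :
  gen [seq x i | i <- enum 'I_r] p <-> exists c, p = \sum_i c i * x i.
Proof.
split.
  have hI : ideal (fun p => exists c, p = \sum_i c i * x i).
    split.
    - by exists (fun=> 0); rewrite big1 // => i _; rewrite mul0r.
    - move=> _ _ [c ->] [c' ->]; exists (fun i => c i + c' i).
      by rewrite -big_split /=; apply: eq_bigr => i _; rewrite mulrDl.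
    - move=> q _ [c ->]; exists (fun i => q * c i).
      by rewrite mulr_sumr; apply: eq_bigr => i _; rewrite mulrA.
  apply: (gen_over_min hI); first by move=> _ ->; apply: (ideal0 hI).
  move=> _ /mapP [i _ ->]; exists (fun j => (j == i)%:R).
  rewrite (bigD1 i) //= eqxx mul1r big1 ?addr0 // => j /negPf ->.
  by rewrite mul0r.
move=> [c ->]; apply: ideal_sum => [|i _]; first exact: gen_ideal.
apply: idealMl; first exact: gen_ideal.
by apply: gen_over_mem; [apply: zero_ideal | apply: map_f; rewrite mem_enum].
Qed.

Lemma zero_of_gen (k : closedFieldType) (N : nat) (s : seq {mpoly k[N]}) z :
  zero_of (gen s) z <-> forall f, f \in s -> f.@[z] = 0.
Proof.
split=> [h f fs|h p].
  by apply: h; apply: gen_over_mem => //; apply: zero_ideal.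
have hJ : ideal (fun p : {mpoly k[N]} => p.@[z] = 0).
  split=> [|p' q h1 h2|p' q h1]; first exact: meval0.
    by rewrite mevalD h1 h2 addr0.
  by rewrite mevalM h1 mulr0.
by apply: (gen_over_min hJ) => // _ ->; apply: meval0.
Qed.

Section Basis.
Variables (k : fieldType) (n : nat).
Local Notation P := {mpoly k[n.+1]}.
Local Notation V d := (dhomog n.+1 k d).

Lemma degree_basis (J : P -> Prop) d : ideal J ->
  exists w : nat -> P,
  [/\ forall j, w j \is d.-homog,
      forall p, p \is d.-homog ->
        exists v : nat -> k, J (p - \sum_(j < HF J d) v j *: w j)
    & forall v : nat -> k, J (\sum_(j < HF J d) v j *: w j) ->
        forall j, (j < HF J d)%N -> v j = 0].
Proof.
move=> hJ; have [U UP] := hspace_exists d hJ.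
have dimUC : HF J d = \dim U^C.
  rewrite /HF dimk_all (dimk_vspace UP) -(dim_hom k n d).
  by rewrite -(addv_complf U) dimv_disjoint_sum ?capv_compl // addKn.
rewrite dimUC; exists (fun j => val (vbasis U^C)`_j); split.
- by move=> j; apply: valP.
- move=> p hp; pose pv : V d := DHomog hp.
  have : pv \in (U + U^C)%VS by rewrite addv_complf memvf.
  move=> /memv_addP [u uU [w wC epv]].
  exists (fun j => if insub j is Some j' then coord (vbasis U^C) j' w else 0).
  have -> : p = val u + val w by rewrite -[p]/(val pv) epv.
  set t := \sum_(j < _) _; have -> : t = val w.
    rewrite [in RHS](coord_vbasis wC) raddf_sum /=.
    by apply: eq_bigr => j _; rewrite valK.
  by rewrite addrK; apply/UP.
- move=> v Jv j lt.
  have hU : \sum_(j < \dim U^C) v j *: (vbasis U^C)`_j \in U.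
    by apply/UP; rewrite raddf_sum.
  have hC : \sum_(j < \dim U^C) v j *: (vbasis U^C)`_j \in U^C%VS.
    apply: memv_suml => i _; apply/memvZ/vbasis_mem/mem_nth.
    by rewrite size_tuple.
  have /eqP s0 : \sum_(j < \dim U^C) v j *: (vbasis U^C)`_j == 0.
    by rewrite -memv0 -(capv_compl U) memv_cap hU.
  have /freeP fr := basis_free (vbasisP U^C).
  exact: (fr (fun i => v i) s0 (Ordinal lt)).
Qed.

(** Bases of complements in the degrees below [M] are concatenated; indexing by [nat] lets each new
    degree be appended by a shift. Independence is stated one degree at a time, as needed for the
    comparison of leading forms. *)
Lemma graded_basis (J : P -> Prop) M : ideal J ->
  (forall i, (M <= i)%N -> HF J i = 0%N) ->
  exists (b : nat -> P) (deg : nat -> nat), let N := (\sum_(i < M) HF J i)%N in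
  [/\ forall j, (j < N)%N -> b j \is (deg j).-homog,
      forall d p, p \is d.-homog -> exists v : nat -> k, J (p - \sum_(j < N) v j *: b j)
    & forall d (v : nat -> k), J (\sum_(j < N | deg j == d) v j *: b j) ->
        forall j, (j < N)%N -> deg j = d -> v j = 0].
Proof.
move=> hJ h0.
have H m : exists (b : nat -> P) (deg : nat -> nat), let N := (\sum_(i < m) HF J i)%N in
  [/\ forall j, (j < N)%N -> (deg j < m)%N /\ b j \is (deg j).-homog,
      forall d p, (d < m)%N -> p \is d.-homog ->
        exists v : nat -> k, J (p - \sum_(j < N) v j *: b j)
    & forall d (v : nat -> k), J (\sum_(j < N | deg j == d) v j *: b j) ->
        forall j, (j < N)%N -> deg j = d -> v j = 0].
  elim: m => [|m [b [deg [hb hs hf]]]].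
    by exists (fun=> 0), id; rewrite big_ord0; split.
  have [w [hw ws wf]] := degree_basis m hJ.
  move: hb hs hf; rewrite big_ord_recr /=; set N := (\sum_(i < m) _)%N => hb hs hf.
  set r := HF J m in ws wf *.
  exists (fun j => if (j < N)%N then b j else w (j - N)%N).
  exists (fun j => if (j < N)%N then deg j else m); split.
  - move=> j lt; case: ifP => ltN; last by [].
    by have [h1 h2] := hb j ltN; split=> //; apply: ltnW.
  - move=> d p; rewrite ltnS leq_eqVlt => /orP[/eqP ->|lt] hp.
      have [v hv] := ws p hp.
      exists (fun j => if (j < N)%N then 0 else v (j - N)%N).
      rewrite big_split_ord /= big1 ?add0r => [|j _]; last by rewrite ltn_ord scale0r.
      under eq_bigr => j _ do rewrite ltnNge leq_addr /= addKn.
      exact: hv.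
    have [v hv] := hs d p lt hp.
    exists (fun j => if (j < N)%N then v j else 0).
    rewrite big_split_ord /= [X in _ - (_ + X)]big1 ?addr0 => [|j _]; last first.
      by rewrite ltnNge leq_addr scale0r.
    by under eq_bigr => j _ do rewrite ltn_ord.
  - move=> d v; rewrite big_mkcond big_split_ord /=.
    under eq_bigr => j _ do rewrite ltn_ord.
    under [X in _ + X]eq_bigr => j _ do rewrite ltnNge leq_addr /= addKn.
    rewrite -big_mkcond /=; case: (altP (m =P d)) => [<-|ne].
      rewrite big1 ?add0r => [Jv j lt|j /eqP e]; last first.
        by have [+ _] := hb j (ltn_ord j); rewrite e ltnn.
      case: ifP => [ltN e|ge _]; first by have [+ _] := hb j ltN; rewrite e ltnn.
      move/negbT: ge; rewrite -leqNgt => le; rewrite -(subnKC le).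
      apply: (wf (fun j => v (N + j)%N) Jv); lia.
    rewrite [X in _ + X]big1 ?addr0 // => Jv j lt.
    case: ifP => [ltN e|_ e]; first exact: hf Jv j ltN e.
    by rewrite e eqxx in ne.
have [b [deg [hb hs hf]]] := H M; exists b, deg; split.
- by move=> j /hb [].
- move=> d p hp; case: (ltnP d M) => [lt|le]; first exact: hs hp.
  have [w [_ ws _]] := degree_basis d hJ.
  have [v] := ws p hp; rewrite h0 // big_ord0 => Jp.
  by exists (fun=> 0); rewrite big1 // => j _; rewrite scale0r.
- exact: hf.
Qed.

End Basis.

(** * The family of perturbations and its discriminant *)

Section Deformation.
Variables (k : closedFieldType) (n r N : nat).
Local Notation P := {mpoly k[n.+1]}.
Local Notation pi := (pihomog mdeg).
Local Notation S := #|{: 'I_r * 'I_n.+1}|.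
Local Notation A := {mpoly k[S]}.
Variables (x : 'I_r -> P) (dx m : 'I_r -> nat).
Variables (b : 'I_N.+1 -> P) (deg : 'I_N.+1 -> nat).
Local Notation xs := [seq x i | i <- enum 'I_r].
Hypothesis hx : forall i, x i \is (dx i).-homog.
Hypothesis hm : forall i, (m i < dx i)%N.
Hypothesis regx : regular_over (fun p => p = 0) xs.
Hypothesis hb : forall j, b j \is (deg j).-homog.
Hypothesis spanb : forall d p, p \is d.-homog ->
  exists v : _ -> k, gen xs (p - \sum_j v j *: b j).
Hypothesis freeb : forall d (v : _ -> k),
  gen xs (\sum_(j | deg j == d) v j *: b j) -> forall j, deg j = d -> v j = 0.

Definition param (C : 'I_S -> k) i l : k := C (enum_rank (i, l)).
(** The subtracted term has degree [m i], assumed below [dx i], so [x i] remains the leading form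
    for all parameters. *)
Definition deform C i : P := x i - \sum_l param C i l *: 'X_l ^+ m i.
Definition deformed C : P -> Prop := gen [seq deform C i | i <- enum 'I_r].

Lemma deformed_ideal C : ideal (deformed C).
Proof. exact: gen_ideal. Qed.

Lemma deformed_gen C i : deformed C (deform C i).
Proof.
by apply: gen_over_mem; [apply: zero_ideal | apply: map_f; rewrite mem_enum].
Qed.

Lemma homogXX (l : 'I_n.+1) e : ('X_l : P) ^+ e \is e.-homog.
Proof.
rewrite -[X in X.-homog]mul1n; apply: dhomogMn; rewrite dhomogX.
exact/eqP/mdeg1.
Qed.

(** The top-degree part of a relation modulo the deformed ideal is a relation modulo the original
    forms, by [initial_form]. *)
Lemma deformed_free C (v : 'I_N.+1 -> k) : deformed C (\sum_j v j *: b j) ->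
  forall j, v j = 0.
Proof.
move=> Iv j0; apply/eqP/negPn/negP => vj0.
case: (@arg_maxnP _ j0 (fun j => v j != 0) deg vj0) => j vj jmax.
pose d := deg j; case/eqP: vj; apply: (@freeb d) => //.
pose s := [seq (deform C i, x i, dx i) | i <- enum 'I_r].
have e1 : [seq t.1.1 | t <- s] = [seq deform C i | i <- enum 'I_r].
  by rewrite -map_comp.
have e2 : [seq t.1.2 | t <- s] = xs by rewrite -map_comp.
have hs t : t \in s -> perturbation t.
  move=> /mapP [i _ ->]; split=> //=.
  have -> : deform C i - x i = - \sum_l param C i l *: 'X_l ^+ m i.
    by rewrite /deform; ring.
  rewrite msizeN; apply: leq_trans (hm i); apply: (@msize_homog _ _ _ (m i)).
  by apply: rpred_sum => l _; apply: rpredZ; apply: homogXX.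
have := @initial_form _ _ s d (\sum_j v j *: b j) hs.
rewrite e1 e2 => /(_ regx Iv) h.
have : gen xs (pi d (\sum_j v j *: b j)).
  apply: h; apply: leq_trans (msize_sum _ _ _) _.
  apply/bigmax_leqP => i _; have [->|vi] := eqVneq (v i) 0.
    by rewrite scale0r msize0.
  apply: leq_trans (msizeZ_le _ _) _; apply: leq_trans (msize_homog (hb i)) _.
  by rewrite ltnS; apply: jmax.
congr (gen xs _); rewrite raddf_sum /= [RHS]big_mkcond /=; apply: eq_bigr => i _.
rewrite linearZ /=; case: eqP => [<-|/eqP ne]; first by rewrite pihomog_dE.
by rewrite (pihomog_ne0 ne (hb i)) scaler0.
Qed.

(** Modulo the deformed ideal each [x i] can be replaced by terms of lower degree, so recursion on
    the degree terminates. The coordinates come out as polynomials in the parameters, valid for all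
    [C] at once. *)
Lemma deformed_span_homog d p : p \is d.-homog ->
  exists V : 'I_N.+1 -> A, forall C, deformed C (p - \sum_j (V j).@[C] *: b j).
Proof.
elim/ltn_ind: d p => d IH p hp.
have [v] := spanb hp; move/gen_codomP => [c ec].
pose c' i := if (dx i <= d)%N then pi (d - dx i) (c i) else 0.
pose v' j := if deg j == d then v j else 0.
have ep : p = \sum_j v' j *: b j + \sum_i c' i * x i.
  rewrite -[LHS](_ : pi d p = p); last by rewrite pihomog_dE.
  have {1}-> : p = \sum_j v j *: b j + \sum_i c i * x i by rewrite -ec addrC subrK.
  rewrite raddfD !raddf_sum /=; congr (_ + _); apply: eq_bigr => i _.
    rewrite linearZ /= /v'; case: eqP => [<-|/eqP ne]; first by rewrite pihomog_dE.
    by rewrite (pihomog_ne0 ne (hb i)) scaler0 scale0r.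
  by rewrite (pihomog_mul _ _ (hx i)) /c'; case: ifP => _; rewrite ?mul0r.
(* The replacement has degree [m i + (d - dx i)], which is below [d]. *)
have hI' i l : exists V : 'I_N.+1 -> A, forall C,
    deformed C ('X_l ^+ m i * c' i - \sum_j (V j).@[C] *: b j).
  rewrite /c'; case: leqP => [le|_].
    apply: (IH (m i + (d - dx i))%N); first by have := hm i; lia.
    by apply: dhomogM; [apply: homogXX | apply: pihomogP].
  exists (fun=> 0) => C; rewrite mulr0 big1 ?subr0; first exact: ideal0 (deformed_ideal C).
  by move=> j _; rewrite meval0 scale0r.
pose V i l := proj1_sig (constructive_indefinite_description _ (hI' i l)).
have hV i l : forall C, deformed C ('X_l ^+ m i * c' i - \sum_j (V i l j).@[C] *: b j).
  exact: (proj2_sig (constructive_indefinite_description _ (hI' i l))).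
exists (fun j => (v' j)%:MP + \sum_i \sum_l 'X_(enum_rank (i, l)) * V i l j) => C.
have -> : p - \sum_j ((v' j)%:MP + \sum_i \sum_l 'X_(enum_rank (i, l)) * V i l j).@[C] *: b j =
  \sum_i (c' i * deform C i +
    \sum_l param C i l *: ('X_l ^+ m i * c' i - \sum_j (V i l j).@[C] *: b j)).
  have -> : \sum_j ((v' j)%:MP + \sum_i \sum_l 'X_(enum_rank (i, l)) * V i l j).@[C] *: b j =
     \sum_j v' j *: b j + \sum_i \sum_l param C i l *: \sum_j (V i l j).@[C] *: b j.
    under eq_bigr => j _ do rewrite mevalD mevalC scalerDl.
    rewrite big_split /=; congr (_ + _).
    under [RHS]eq_bigr => i _ do under eq_bigr => l _ do rewrite scaler_sumr.
    under [RHS]eq_bigr => i _ do rewrite exchange_big /=.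
    rewrite [RHS]exchange_big /=; apply: eq_bigr => j _.
    rewrite raddf_sum scaler_suml; apply: eq_bigr => i _.
    rewrite raddf_sum scaler_suml; apply: eq_bigr => l _.
    by rewrite /= mevalM mevalXU scalerA.
  rewrite ep opprD addrACA subrr add0r -sumrB; apply: eq_bigr => i _.
  under [X in _ = _ + X]eq_bigr => l _ do rewrite scalerBr.
  rewrite sumrB addrA; congr (_ - _).
  have -> : \sum_l param C i l *: ('X_l ^+ m i * c' i) =
      c' i * \sum_l param C i l *: 'X_l ^+ m i.
    by rewrite mulr_sumr; apply: eq_bigr => l _; rewrite -scalerAr mulrC.
  by rewrite /deform mulrBr subrK.
have hI := deformed_ideal C.
apply: ideal_sum => // i _; apply: idealD => //.
  by apply: idealMl => //; apply: deformed_gen.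
by apply: ideal_sum => // l _; apply: idealZ => //; apply: hV.
Qed.

Lemma deformed_span p : exists V : 'I_N.+1 -> A, forall C,
  deformed C (p - \sum_j (V j).@[C] *: b j).
Proof.
have h d := deformed_span_homog (pihomogP mdeg d p).
pose V d := proj1_sig (constructive_indefinite_description _ (h d)).
have hV d : forall C, deformed C (pi d p - \sum_j (V d j).@[C] *: b j).
  exact: (proj2_sig (constructive_indefinite_description _ (h d))).
exists (fun j => \sum_(d < msize p) V d j) => C.
have -> : p - \sum_j (\sum_(d < msize p) V d j).@[C] *: b j =
    \sum_(d < msize p) (pi d p - \sum_j (V d j).@[C] *: b j).
  rewrite sumrB -(pihomog_partitionE (leqnn _)); congr (_ - _).
  rewrite [RHS]exchange_big /=; apply: eq_bigr => j _.
  by rewrite raddf_sum scaler_suml.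
by apply: ideal_sum => [|d _]; [apply: deformed_ideal | apply: hV].
Qed.

Lemma deformed_span1 C p : exists v : _ -> k, deformed C (p - \sum_j v j *: b j).
Proof. by have [V hV] := deformed_span p; exists (fun j => (V j).@[C]). Qed.

Hypothesis char0 : [pchar k] =i pred0.
Variable i0 : 'I_r.
Hypothesis m0 : m i0 = 0%N.

Let span C := deformed_span1 C.
Let free C := @deformed_free C.
Let hI C := deformed_ideal C.

Lemma trace_poly p : exists t : A, forall C, \tr (mulmat (span C) p) = t.@[C].
Proof.
have h i := deformed_span (p * b i).
pose V i := proj1_sig (constructive_indefinite_description _ (h i)).
have hV i : forall C, deformed C (p * b i - \sum_j (V i j).@[C] *: b j).
  exact: (proj2_sig (constructive_indefinite_description _ (h i))).
exists (\sum_i V i i) => C; rewrite raddf_sum /=; apply: eq_bigr => i _.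
rewrite mxE (@coords_uniq _ _ _ _ _ (hI C) (span C) (@free C) _ (\row_j (V i j).@[C])).
  by rewrite mxE.
by rewrite /lincomb; under eq_bigr => j _ do rewrite mxE; apply: hV.
Qed.

Definition update C (l0 : 'I_n.+1) (y : 'I_r -> k) : 'I_S -> k :=
  fun s => if (enum_val s).2 == l0 then y (enum_val s).1 else C s.

Lemma param_update C l0 y i l :
  param (update C l0 y) i l = if l == l0 then y i else param C i l.
Proof. by rewrite /param /update enum_rankK. Qed.

Lemma update_id C l0 : update C l0 (fun i => param C i l0) = C.
Proof.
apply: functional_extensionality => s; rewrite /update /param.
case: eqP => // <-; congr C; rewrite -[RHS]enum_valK; congr enum_rank.
by case: (enum_val s).
Qed.

(* The parameters [param C i l0] can be eliminated at the cost of a power of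
   ['X_l0], because [deform C i] is linear in them. *)
Definition eliminable C l0 (Phi : ('I_S -> k) -> P) := exists M psi, forall y,
  deformed (update C l0 y) ('X_l0 ^+ M * Phi (update C l0 y) - psi).

Lemma eliminable_cst C l0 p : eliminable C l0 (fun=> p).
Proof.
by exists 0%N, p => y; rewrite expr0 mul1r subrr; apply: ideal0 (hI _).
Qed.

Lemma eliminable_add C l0 Phi Psi : eliminable C l0 Phi -> eliminable C l0 Psi ->
  eliminable C l0 (fun c => Phi c + Psi c).
Proof.
move=> [M [p hp]] [M' [p' hp']].
exists (M + M')%N, ('X_l0 ^+ M' * p + 'X_l0 ^+ M * p') => y.
set c := update C l0 y; rewrite exprD.
have -> : 'X_l0 ^+ M * 'X_l0 ^+ M' * (Phi c + Psi c) -
    ('X_l0 ^+ M' * p + 'X_l0 ^+ M * p') =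
    'X_l0 ^+ M' * ('X_l0 ^+ M * Phi c - p) +
    'X_l0 ^+ M * ('X_l0 ^+ M' * Psi c - p') by ring.
by apply: (idealD (hI _)); apply: (idealMl (hI _)); [apply: hp | apply: hp'].
Qed.

Lemma eliminable_mul C l0 Phi Psi : eliminable C l0 Phi -> eliminable C l0 Psi ->
  eliminable C l0 (fun c => Phi c * Psi c).
Proof.
move=> [M [p hp]] [M' [p' hp']]; exists (M + M')%N, (p * p') => y.
set c := update C l0 y; rewrite exprD.
have -> : 'X_l0 ^+ M * 'X_l0 ^+ M' * (Phi c * Psi c) - p * p' =
    ('X_l0 ^+ M' * Psi c) * ('X_l0 ^+ M * Phi c - p) +
    p * ('X_l0 ^+ M' * Psi c - p') by ring.
by apply: (idealD (hI _)); apply: (idealMl (hI _)); [apply: hp | apply: hp'].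
Qed.

Lemma eliminable_poly C l0 (v : A) : eliminable C l0 (fun c => (v.@[c])%:MP).
Proof.
have ext Phi Psi : Phi =1 Psi -> eliminable C l0 Phi -> eliminable C l0 Psi.
  by move=> e; rewrite (functional_extensionality _ _ e).
elim/mpoly_alg_ind: v => [c|s|p q hp hq|p q hp hq].
- by apply: ext (eliminable_cst C l0 c%:MP) => C'; rewrite mevalC.
- have -> : s = enum_rank (enum_val s) by rewrite enum_valK.
  case: (enum_val s) => i l.
  have [->|ne] := eqVneq l l0; last first.
    exists 0%N, (param C i l)%:MP => y; rewrite expr0 mul1r mevalXU.
    rewrite -/(param (update C l0 y) i l) param_update (negPf ne) subrr.
    exact: ideal0 (hI _).
  (* The equation [deform C i = 0] solved for the parameter at [(i, l0)], which is multiplied by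
     ['X_l0 ^+ m i]. *)
  exists (m i), (x i - \sum_(l | l != l0) param C i l *: 'X_l ^+ m i) => y.
  rewrite mevalXU -/(param (update C l0 y) i l0).
  have -> : 'X_l0 ^+ m i * (param (update C l0 y) i l0)%:MP -
      (x i - \sum_(l | l != l0) param C i l *: 'X_l ^+ m i) =
      - deform (update C l0 y) i.
    rewrite /deform [in RHS](bigD1 l0) //= mulrC mul_mpolyC.
    rewrite [X in - (_ - (_ + X))](eq_bigr (fun l => param C i l *: 'X_l ^+ m i)).
      ring.
    by move=> l' ne; rewrite param_update (negPf ne).
  rewrite -/(param (update C l0 y) i l0).
  exact: idealN (hI _) (deformed_gen _ i).
- apply: ext (eliminable_add hp hq) => C'.
  by rewrite mevalD mpolyCD.
- apply: ext (eliminable_mul hp hq) => C'.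
  by rewrite mevalM mpolyCM.
Qed.

Lemma eliminable_sum C l0 (J : finType) (Phi : J -> ('I_S -> k) -> P) :
  (forall j, eliminable C l0 (Phi j)) ->
  eliminable C l0 (fun c => \sum_j Phi j c).
Proof.
move=> h; elim: (index_enum J) => [|j s IH].
  by have [M [p hp]] := eliminable_cst C l0 0; exists M, p => y; rewrite big_nil.
have [M [p hp]] := eliminable_add (h j) IH.
by exists M, p => y; rewrite big_cons.
Qed.

Lemma zero_ofE C z : zero_of (deformed C) z <-> forall i, (deform C i).@[z] = 0.
Proof.
rewrite zero_of_gen; split=> [h i|h _ /mapP [i _ ->]]; last exact: h.
by apply: h; apply: map_f; rewrite mem_enum.
Qed.

Lemma X_neq0 (l : 'I_n.+1) : ('X_l : P) != 0.
Proof.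
by apply/eqP => /(congr1 (meval (fun=> 1))); rewrite mevalXU meval0 => /eqP;
   rewrite oner_eq0.
Qed.

(** The polynomial [psi] does not depend on the eliminated parameters. Any point with nonzero
    coordinate [l0] is a zero of the deformed ideal for suitable values of them, so ['X_l0 * psi]
    vanishes everywhere and [psi] is zero. *)
Lemma eliminable_vanishing C l0 (Phi : ('I_S -> k) -> P) :
  eliminable C l0 Phi ->
  (forall C' z, zero_of (deformed C') z -> (Phi C').@[z] = 0) ->
  exists M, deformed C ('X_l0 ^+ M * Phi C).
Proof.
move=> [M [psi h]] van; exists M.
suff psi0 : psi = 0.
  by have := h (fun i => param C i l0); rewrite update_id psi0 subr0.
apply: (mulfI (X_neq0 l0)); rewrite mulr0; apply: mpoly_vanishing => z.
rewrite mevalM mevalXU; have [->|z0] := eqVneq (z l0) 0; first by rewrite mul0r.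
(* The values of the eliminated parameters that make [z] satisfy every equation. *)
pose y i := (x i - \sum_(l | l != l0) param C i l *: 'X_l ^+ m i).@[z] / z l0 ^+ m i.
have hz : zero_of (deformed (update C l0 y)) z.
  apply/zero_ofE => i; rewrite /deform (bigD1 l0) //= param_update eqxx.
  rewrite (eq_bigr (fun l => param C i l *: 'X_l ^+ m i)); last first.
    by move=> l' ne; rewrite param_update (negPf ne).
  rewrite opprD addrCA addrC mevalD mevalN mevalZ rmorphXn /= mevalXU /y.
  by rewrite divfK ?expf_neq0 // subrr.
have := hz _ (h y); rewrite mevalB mevalM van // mulr0 sub0r => /eqP.
by rewrite oppr_eq0 => /eqP ->; rewrite mulr0.
Qed.

(** The constant subtracted from [x i0], since [m i0 = 0] turns each power of a variable into 1. *)
Definition shift_value (C : 'I_S -> k) : k := \sum_l param C i0 l.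

Lemma shift_poly : exists2 t : A, t != 0 & forall C, t.@[C] = shift_value C.
Proof.
pose t : A := \sum_l 'X_(enum_rank (i0, l)).
have tE C : t.@[C] = shift_value C.
  by rewrite raddf_sum; apply: eq_bigr => l _; rewrite /= mevalXU.
exists t => //; apply/eqP => t0.
have := tE (fun s => ((enum_val s).2 == ord0)%:R).
rewrite t0 meval0 /shift_value (bigD1 ord0) //= /param enum_rankK eqxx.
rewrite big1 ?addr0 => [/esym/eqP|l /negPf ne]; first by rewrite oner_eq0.
by rewrite enum_rankK /= ne.
Qed.

Lemma deform_shift C : deform C i0 = x i0 - (shift_value C)%:MP.
Proof.
rewrite /deform m0 /shift_value; congr (_ - _); rewrite raddf_sum /=.
by apply: eq_bigr => l _; rewrite expr0 -mul_mpolyC mulr1.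
Qed.

Lemma homog_eval0 (p : P) d : (0 < d)%N -> p \is d.-homog -> p.@[fun=> 0] = 0.
Proof.
move=> d0 hp; rewrite mevalE big_seq big1 // => mn ms.
have e : mdeg mn = d := dhomog_mf hp ms; rewrite mdegE in e.
have [i mi] : exists i, (0 < mn i)%N.
  apply/existsP; apply: contraTT d0; rewrite negb_exists -e => /forallP h.
  rewrite -leqNgt leqn0 sum_nat_eq0; apply/forallP => i; apply/implyP => _.
  by rewrite -leqn0 leqNgt.
by rewrite (bigD1 i) //= expr0n eqn0Ngt mi mul0r mulr0.
Qed.

(** If the class of [Phi C] were nonzero, a common eigenvector among its multiples would give a zero
    of the ideal. Powers of every variable kill [Phi C], so that zero is the origin, where
    [deform C i0] takes the value [- shift_value C]. *)
Lemma vanishing_family C (Phi : ('I_S -> k) -> P) :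
  (forall l0, eliminable C l0 Phi) ->
  (forall C' z, zero_of (deformed C') z -> (Phi C').@[z] = 0) ->
  shift_value C != 0 -> deformed C (Phi C).
Proof.
move=> el van t0; apply: NNPP => nPhi.
have [z [s' [ns hz]]] := common_eigenvector (hI C) (span C) (@free C) nPhi.
have cst c : deformed C (c%:MP * (Phi C * s')) -> c = 0.
  move=> Ic; apply/eqP/negPn/negP => c0; apply: ns.
  have := idealZ c^-1 (hI C) Ic.
  by rewrite mul_mpolyC scalerA mulVf // scale1r.
have hz0 h : deformed C (h * (Phi C * s')) -> h.@[z] = 0.
  move=> Ih; apply: cst; apply: (ideal_sub_trans (hI C) _ Ih).
  by rewrite -mulrBl -opprB mulNr; apply: (idealN (hI C)); apply: hz.
have z0 : z =1 (fun=> 0).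
  move=> l; have [M hM] := eliminable_vanishing (el l) van.
  have : ('X_l ^+ M : P).@[z] = 0.
    by apply: hz0; rewrite mulrA; apply: (ideal_mulr _ (hI C)).
  by rewrite rmorphXn /= mevalXU => /eqP; rewrite expf_eq0 => /andP[_ /eqP].
have : (deform C i0).@[z] = 0.
  by apply: hz0; apply: (ideal_mulr _ (hI C)); apply: deformed_gen.
rewrite deform_shift mevalB mevalC (meval_eq _ z0).
rewrite (homog_eval0 _ (hx i0)); last by apply: leq_ltn_trans (hm i0).
by rewrite sub0r => /eqP; rewrite oppr_eq0 (negPf t0).
Qed.

Lemma generic_gram : exists G : 'M[A]_N.+1,
  (forall C, map_mx (meval C) G = gram (span C)) /\ \det G != 0.
Proof.
have h i j := trace_poly (b i * b j).
pose G : 'M[A]_N.+1 := \matrix_(i, j)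
  proj1_sig (constructive_indefinite_description _ (h i j)).
have hG C : map_mx (meval C) G = gram (span C).
  apply/matrixP => i j; rewrite !mxE.
  by rewrite (proj2_sig (constructive_indefinite_description _ (h i j)) C).
(* A singular matrix over the domain [A] has a kernel vector with polynomial entries, which defines
   a family [Phi] in the radicals of the trace forms. *)
exists G; split=> //; apply/negP => /det0P [v v0 vG].
pose Phi C := \sum_j ((v 0 j).@[C])%:MP * b j.
have PhiE C : Phi C = lincomb b (map_mx (meval C) v).
  by apply: eq_bigr => j _; rewrite mxE mul_mpolyC.
have van C z : zero_of (deformed C) z -> (Phi C).@[z] = 0.
  move=> hz; have [j|s hs] := tr_vanishing (span_b := span C) (hI C) (@free C) (p := Phi C) char0.
    rewrite PhiE (tr_lincomb (hI C) (span C) (@free C)) -hG -map_mxM vG.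
    by rewrite map_mx0 mxE.
  by have /eqP := hz _ hs; rewrite rmorphXn expf_eq0 => /andP[_ /eqP].
have el C l0 : eliminable C l0 Phi.
  apply: eliminable_sum => j; apply: eliminable_mul; first exact: eliminable_poly.
  exact: eliminable_cst.
have hv C : shift_value C != 0 -> forall j, (v 0 j).@[C] = 0.
  move=> t0 j; apply: (@free C (fun j => (v 0 j).@[C])).
  have := vanishing_family (el C) van t0; rewrite /Phi.
  by under eq_bigr => l _ do rewrite mul_mpolyC.
case/eqP: v0; apply/rowP => j; rewrite [RHS]mxE.
have [t t0 tE] := shift_poly.
(* Multiplication by [t] takes care of the parameters with [shift_value C = 0], where nothing is
   known about [v]. *)
apply: (mulfI t0); rewrite mulr0; apply: mpoly_vanishing => C.
rewrite mevalM tE; have [->|/hv ->] := eqVneq (shift_value C) 0.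
  by rewrite mul0r.
by rewrite mulr0.
Qed.

Lemma generic_radical : exists c : 'I_r -> 'I_n.+1 -> k,
  let I := gen [seq x i - \sum_l c i l *: 'X_l ^+ m i | i <- enum 'I_r] in
  [/\ \sum_l c i0 l != 0,
      forall p, (forall z, zero_of I z -> p.@[z] = 0) -> I p
    & forall R (y : 'I_R -> 'I_n.+1 -> k), (forall j, zero_of I (y j)) ->
        (forall j j', j != j' -> exists i, y j i != y j' i) -> (R <= N.+1)%N].
Proof.
have [G [hG dG]] := generic_gram.
have [t t0 tE] := shift_poly.
have [C] := mpoly_nonvanishing (mulf_neq0 t0 dG).
rewrite mevalM mulf_eq0 negb_or tE => /andP[tC dC].
exists (param C) => /=; split=> //.
- move=> p hp; apply: (gram_radical (hI C) (span_b := span C) (@free C)) => //.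
  by rewrite -hG det_map_mx.
- by move=> R y hy dy; apply: (card_zeros (hI C) (span C) (@free C) hy dy).
Qed.

End Deformation.

(** * The rank of F *)

Lemma natr_neq0 (k : fieldType) m : [pchar k] =i pred0 -> (0 < m)%N -> m%:R != 0 :> k.
Proof. by move/pcharf0P => ->; rewrite -lt0n. Qed.

(** * From vanishing conditions to sums of powers *)

Section Duality.
Variables (k : closedFieldType) (N : nat).
Local Notation P := {mpoly k[N]}.
Hypothesis char0 : [pchar k] =i pred0.

Lemma mderivm_coef0 (F : P) mn : (mderivm mn F)@_0 = 0 -> F@_mn = 0.
Proof.
rewrite mcoeff_mderivm addm0 => /eqP; rewrite -mulr_natr mulf_eq0.
case/orP=> [/eqP //|]; rewrite (negPf (natr_neq0 char0 _)) //.
by rewrite prodn_gt0 // => i; rewrite ffactnn fact_gt0.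
Qed.

(** Pairing with [F] is a linear functional on forms of degree [D] which vanishes wherever all
    evaluations at the [y j] do, hence is a combination of these. Evaluation at [y j] is the pairing
    with the power of [lform (y j)], up to a factorial. *)
Lemma apolar_duality (F : P) D s (y : 'I_s -> 'I_N -> k) : F \is D.-homog ->
  (forall p, p \is D.-homog -> (forall j, p.@[y j] = 0) -> apolar p F = 0) ->
  exists c : 'I_s -> k, F = \sum_j c j *: lform (y j) ^+ D.
Proof.
move=> hF hp; pose K0 := #|{: 'X_{1..N < D.+1}}|.
pose en (i : 'I_K0) : 'X_{1..N < D.+1} := enum_val i.
pose B : 'M[k]_(s, K0) := \matrix_(j < s, i < K0)
  if mdeg (en i) == D then ('X_[en i] : P).@[y j] else 0.
pose phi : 'rV[k]_K0 := \row_i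
  if mdeg (en i) == D then (mderivm (en i) F)@_0 else 0.
have : (phi <= B)%MS.
  rewrite submxE; move: (cokermx B) (mulmx_coker B) => K BK.
  apply/eqP/rowP => c; rewrite [RHS]mxE.
  (* A column of the cokernel of [B] lists the coefficients of a form vanishing at all the
     points. *)
  pose p : P := \sum_(i < K0 | mdeg (en i) == D) K i c *: 'X_[en i].
  have hom : p \is D.-homog.
    by apply: rpred_sum => i hi; apply: rpredZ; rewrite dhomogX.
  have pv j : p.@[y j] = 0.
    have := congr1 (fun M : 'M_(s, _) => M j c) BK.
    rewrite !mxE => <-; rewrite /p raddf_sum big_mkcond /=; apply: eq_bigr => i _.
    rewrite mxE; case: ifP => _; last by rewrite mul0r.
    by rewrite mevalZ mulrC.
  have := congr1 (mcoeff 0) (hp p hom pv).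
  rewrite (apolarwE _ (msize_homog hom)) mcoeff0 raddf_sum /= => <-.
  rewrite mxE (reindex_onto en enum_rank) /=; last by move=> i _; rewrite /en enum_rankK.
  rewrite [RHS](eq_bigl xpredT); last by move=> i; rewrite /en enum_valK eqxx.
  apply: eq_bigr => i _; rewrite mxE mcoeffZ.
  have -> : p@_(en i) = if mdeg (en i) == D then K i c else 0.
    rewrite /p raddf_sum /= big_mkcond (bigD1 i) //= big1 ?addr0.
      by case: ifP => _ //; rewrite mcoeffZ mcoeffX eqxx mulr1.
    move=> i' ne; case: ifP => // _; rewrite mcoeffZ mcoeffX.
    case: eqP => [/val_inj /enum_val_inj e|_]; last by rewrite mulr0.
    by rewrite e eqxx in ne.
  by case: ifP => _; rewrite ?mul0r // mulrC.
move=> /submxP [c ephi]; exists (fun j => c 0 j / D`!%:R).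
have fD0 : D`!%:R != 0 :> k by apply: natr_neq0 => //; apply: fact_gt0.
apply/eqP; rewrite -subr_eq0; apply/eqP/mpolyP => mn; rewrite mcoeff0.
set G := _ - _.
have hG : G \is D.-homog.
  apply: rpredB => //; apply: rpred_sum => j _; apply: rpredZ.
  by have := dhomogMn D (lform_homog (y j)); rewrite mul1n.
have [e|ne] := eqVneq (mdeg mn) D; last exact: (dhomog_nemf_coeff hG).
apply: mderivm_coef0; rewrite /G raddfB raddf_sum /= mcoeffB raddf_sum /=.
apply/eqP; rewrite subr_eq0; apply/eqP.
have lt : (mdeg mn < D.+1)%N by rewrite e.
have := congr1 (fun M : 'rV_ _ => M 0 (enum_rank (BMultinom lt))) ephi.
rewrite !mxE /en enum_rankK /= e eqxx => ->; apply: eq_bigr => j _.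
rewrite mxE /en enum_rankK /= e eqxx linearZ /= mderivm_lform_exp e subnn expr0.
by rewrite !mcoeffZ mcoeff1 eqxx mulr1 ffactnn mulrA divfK.
Qed.

Lemma power_sum_of_lincomb (F : P) D s (y : 'I_s -> 'I_N -> k) (c : 'I_s -> k) :
  (0 < D)%N -> F \is D.-homog -> F != 0 ->
  F = \sum_j c j *: lform (y j) ^+ D -> power_sum_len F s.
Proof.
move=> D0 hF F0 eF.
have eD : (msize F).-1 = D.
  exact: (dhomog_uniq F0 (dhomog_msize hF) hF).
have rt j : exists z, z ^+ D = c j.
  have /closed_rootP [z] : size ('X^D - (c j)%:P) != 1%N.
    by rewrite size_XnsubC // eqSS -lt0n.
  by rewrite rootE !hornerE subr_eq0 => /eqP; exists z.
pose z j := proj1_sig (constructive_indefinite_description _ (rt j)).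
have zD j : z j ^+ D = c j.
  exact: (proj2_sig (constructive_indefinite_description _ (rt j))).
exists (fun j => z j *: lform (y j)); split.
  by move=> j; apply: rpredZ; apply: lform_homog.
by rewrite eD {1}eF; apply: eq_bigr => j _; rewrite exprZn zD.
Qed.

End Duality.

Section Descent.
Variables (k : fieldType) (N : nat).
Local Notation P := {mpoly k[N]}.
Local Notation pi := (pihomog mdeg).

(** In each degree [i] other than [D], [q] times the part of [u] in degree [i - e] is congruent to
    [t] times its part in degree [i]. Dividing by [t] from degree 0 upwards, and by [q] from the top
    degree downwards, puts every component of [u] in [J]. *)
Lemma homog_descent (J : P -> Prop) (q : P) e t D p u :
  ideal J -> graded J -> q \is e.-homog -> (0 < e)%N -> t != 0 ->
  (forall h, J (q * h) -> J h) -> p \is D.-homog ->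
  J (p - u * (q - t%:MP)) -> J p.
Proof.
move=> hJ gJ hq e0 t0 rq hp Jpu.
pose w i := (if (e <= i)%N then pi (i - e) u * q else 0).
have comp i : J (pi i p - (w i - t *: pi i u)).
  have := gJ i _ Jpu; rewrite raddfB /= mulrBr raddfB /=.
  by rewrite (pihomog_mul _ _ hq) [u * t%:MP]mulrC mul_mpolyC linearZ.
have comp0 i : i != D -> J (w i - t *: pi i u).
  move=> ne; have := comp i; rewrite (pihomog_ne0 _ hp) 1?eq_sym // sub0r.
  by move/(idealN hJ); rewrite opprK.
have low i : (i < D)%N -> J (pi i u).
  elim/ltn_ind: i => i IH lt.
  have Jw : J (w i).
    rewrite /w; case: leqP => [le|_]; last exact: ideal0.
    by apply: ideal_mulr => //; apply: IH; lia.
  have := idealB hJ Jw (comp0 i _); rewrite ltn_eqF // => /(_ isT).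
  rewrite opprB addrCA subrr addr0 => /(idealZ t^-1 hJ).
  by rewrite scalerA mulVf // scale1r.
have high l i : (msize u <= i + l)%N -> (D < i + e)%N -> J (pi i u).
  elim: l i => [|l IH] i hl lt.
    by rewrite pihomog_msize; [apply: ideal0 | rewrite addn0 in hl].
  have Ju : J (pi (i + e) u) by apply: IH; lia.
  have := comp0 (i + e)%N; rewrite gtn_eqF // => /(_ isT).
  rewrite /w leq_addl addnK => h; apply: rq; rewrite mulrC.
  by apply: (ideal_sub_trans hJ h); apply: idealZ.
have Ju : J u.
  apply: graded_pihomog => // i; case: (ltnP i D) => [|le]; first exact: low.
  by apply: (high (msize u)); lia.
by apply: (ideal_sub_trans hJ Jpu); apply: ideal_mulr.
Qed.

Lemma gen_low_degree (s : seq P) d p :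
  (forall f, f \in s -> exists2 e, f \is e.-homog & (d < e)%N) ->
  gen s p -> pi d p = 0.
Proof.
elim/last_ind: s p => [|s f IH] p hs; first by move=> /= ->; rewrite raddf0.
rewrite gen_rcons => -[a [b [ga ->]]].
have [|e he lt] := hs f; first by rewrite mem_rcons mem_head.
rewrite raddfD /= (pihomog_mul _ _ he) leqNgt lt addr0; apply: IH => //.
by move=> g gs; apply: hs; rewrite mem_rcons in_cons gs orbT.
Qed.

Lemma wrank_spec (F : P) r : power_sum_len F r ->
  power_sum_len F (wrank F) /\ (wrank F <= r)%N.
Proof.
move=> h; rewrite /wrank; case: excluded_middle_informative => [ex|[]]; last by exists r.
case: ex_minnP => m hm mmin; split.
  by move: hm; case: excluded_middle_informative.
by apply: mmin; case: excluded_middle_informative.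
Qed.

Lemma meval_scale (p : P) d c z : p \is d.-homog ->
  p.@[fun i => c * z i] = c ^+ d * p.@[z].
Proof.
move=> hp; rewrite !mevalE mulr_sumr big_seq [RHS]big_seq; apply: eq_bigr => m ms.
have e : mdeg m = d := dhomog_mf hp ms.
rewrite mulrCA; congr (_ * _); rewrite -e mdegE -prodrXr -big_split /=.
by apply: eq_bigr => i _; rewrite exprMn.
Qed.

End Descent.

Lemma roots_of_unity (k : closedFieldType) e : [pchar k] =i pred0 -> (0 < e)%N ->
  exists zeta : 'I_e -> k, injective zeta /\ forall i, zeta i ^+ e = 1.
Proof.
move=> char0 e0; have [rs ers] := closed_field_poly_normal ('X^e - 1 : {poly k}).
have mon : lead_coef ('X^e - 1 : {poly k}) = 1.
  by rewrite lead_coefDl ?lead_coefXn // size_polyXn size_polyN size_poly1.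
rewrite mon scale1r in ers.
have sz : size rs = e.
  by apply/eqP; rewrite -eqSS -(size_prod_XsubC rs id) -ers size_Xn_sub_1.
have un : uniq rs.
  by rewrite -separable_prod_XsubC -ers separable_Xn_sub_1 // natr_neq0.
exists (fun i => rs`_i); split.
  move=> i j /eqP; rewrite nth_uniq ?sz // => /eqP; exact: val_inj.
move=> i; have : root ('X^e - 1 : {poly k}) rs`_i.
  by rewrite ers root_prod_XsubC mem_nth // sz.
by rewrite rootE !hornerE subr_eq0 => /eqP.
Qed.

Section Glue.
Variables (n : nat) (T : Type) (f : 'I_n -> T) (z : T).

(** Adjoins [q] to the [g i] as the last member of one family, so that the deformation applies with
    [ord_max] as the distinguished index. *)
Definition glue (i : 'I_n.+1) : T := if unlift ord_max i is Some j then f j else z.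

Lemma glue_lift j : glue (lift ord_max j) = f j.
Proof. by rewrite /glue liftK. Qed.

Lemma glue_max : glue ord_max = z.
Proof. by rewrite /glue unlift_none. Qed.

Lemma glue_map : [seq glue i | i <- enum 'I_n.+1] = rcons [seq f i | i <- enum 'I_n] z.
Proof.
rewrite enum_ordSr map_rcons glue_max -map_comp; congr rcons.
apply: eq_map => j /=; rewrite -glue_lift; congr glue.
by apply: val_inj; rewrite /= /bump leqNgt ltn_ord.
Qed.

End Glue.

(** * The ideal of [q] and the [g i], and both bounds for the rank *)

Section Main.
Variables (k : closedFieldType) (n : nat).
Local Notation P := {mpoly k[n.+1]}.
Variables (F : P) (D : nat) (q : P) (g : 'I_n -> P) (a e : nat) (d : 'I_n -> nat).
Hypothesis hk : [pchar k] =i pred0.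
Hypothesis hF : F \is D.-homog.
Hypotheses (hq : q \is e.-homog) (hg : forall i, g i \is (d i).-homog).
Hypotheses (ha : (2 <= a)%N) (he : (0 < e)%N).
Hypothesis hd1 : forall i : 'I_n, (a * e <= d i)%N.
Hypothesis hCI : complete_intersection_by (perp F)
  (q ^+ a :: [seq g i | i <- enum 'I_n]).

Local Notation gs := [seq g i | i <- enum 'I_n].
Local Notation x := (glue g q).
Local Notation dx := (glue d e).
Local Notation xs := [seq x i | i <- enum 'I_n.+1].

Let ae0 : (0 < a * e)%N. Proof. by rewrite muln_gt0 he andbT ltnW. Qed.

Let hqa : q ^+ a \is (a * e).-homog.
Proof. by rewrite mulnC; apply: dhomogMn. Qed.

Lemma perpE : perp F = gen (q ^+ a :: gs).
Proof. by rewrite -ideal_ofE; apply: pred_ext; case: hCI. Qed.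

Lemma regular_gens : regular_over (fun p : P => p = 0) (q ^+ a :: gs).
Proof. by apply: regular_seq_over; case: hCI. Qed.

Lemma gens_proper : ~ gen (q ^+ a :: gs) 1.
Proof. by rewrite -ideal_ofE; case: hCI => _ []. Qed.

Lemma F_neq0 : F != 0.
Proof.
apply/eqP => F0; apply: gens_proper; rewrite -perpE /perp F0 /apolar.
by rewrite big1 // => m _; rewrite raddf0 scaler0.
Qed.

Lemma gens_neq0 : 0 \notin q ^+ a :: gs.
Proof. exact: regular_nonzero (@zero_ideal _ _) gens_proper regular_gens. Qed.

Lemma q_neq0 : q != 0.
Proof.
apply: contra gens_neq0 => /eqP ->.
by rewrite expr0n gtn_eqF ?(ltnW ha) // in_cons eqxx.
Qed.

Lemma x_homog i : x i \is (dx i).-homog.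
Proof. by case: (unliftP ord_max i) => [j|] ->; rewrite ?glue_lift ?glue_max. Qed.

Lemma xsE : xs = rcons gs q. Proof. exact: glue_map. Qed.

Lemma gs_homog (g' : 'I_n -> P) : (forall i, g' i \is (d i).-homog) ->
  {in [seq g' i | i <- enum 'I_n], forall f, exists e, f \is e.-homog}.
Proof. by move=> h _ /mapP [i _ ->]; exists (d i). Qed.

(** The family [g'] is arbitrary because this is applied to the [g i] and again to their
    deformations. The power of [q] is rotated to the end, and a factor of a nonzerodivisor is one
    too. *)
Lemma nonzerodiv_q (g' : 'I_n -> P) : (forall i, g' i \is (d i).-homog) ->
  regular_over (fun p : P => p = 0) (q ^+ a :: [seq g' i | i <- enum 'I_n]) ->
  regular_over (fun p : P => p = 0) [seq g' i | i <- enum 'I_n] /\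
  forall h, gen [seq g' i | i <- enum 'I_n] (q * h) -> gen [seq g' i | i <- enum 'I_n] h.
Proof.
move=> hg' reg.
have := regular_rot (@zero_ideal _ _) (@zero_graded _ _) hqa ae0 (gs_homog hg') reg.
rewrite -cats1 => /regular_over_cat [rg [rq _]]; split=> //.
by apply: nonzerodiv_root rq; [apply: gen_ideal | lia].
Qed.

Lemma regular_xs : regular_over (fun p : P => p = 0) xs.
Proof.
rewrite xsE -cats1; apply/regular_over_cat.
by have [rg rq] := nonzerodiv_q hg regular_gens.
Qed.

Lemma xs_neq0 : 0 \notin xs.
Proof.
rewrite xsE mem_rcons in_cons negb_or eq_sym q_neq0 /=.
by have := gens_neq0; rewrite in_cons negb_or => /andP[].
Qed.

Lemma HF_xs : exists M : nat, (forall i, (M <= i)%N -> HF (gen xs) i = 0%N) /\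
  (\sum_(i < M) HF (gen xs) i = (\prod_(i < n) d i) * e)%N.
Proof.
have sz : size xs = n.+1 by rewrite size_map size_enum_ord.
have [|i lt|||M [h0 hs]] :=
  @HF_regular_sum k n xs [seq dx i | i <- enum 'I_n.+1] sz.
- by rewrite !size_map.
- have lt' : (i < size (enum 'I_n.+1))%N by rewrite -(size_map x).
  by rewrite (nth_map ord0 0 x lt') (nth_map ord0 0%N dx lt'); apply: x_homog.
- exact: xs_neq0.
- exact: regular_xs.
exists M; split=> //; rewrite hs glue_map big_rcons /= big_map big_enum /=.
by rewrite mulnC.
Qed.

Lemma colonE h : colon (perp F) (ideal_of [:: q]) h <-> gen (q ^+ a :: gs) (h * q).
Proof.
rewrite perpE ideal_ofE; split=> [h1|h1 f].
  by apply: h1; apply: gen_over_mem; [apply: zero_ideal | rewrite mem_head].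
move=> [_ [b [-> ->]]]; rewrite add0r mulrCA; apply: idealMl => //.
exact: gen_ideal.
Qed.

(** If [h * q = c + u * q ^+ a] with [c] in the ideal of the [g i], cancelling [q] gives [h]
    congruent to [u * q ^+ a.-1], which is a multiple of [q] because [2 <= a]. *)
Lemma quotient_by_q : add_principal (colon (perp F) (ideal_of [:: q])) q = gen xs.
Proof.
have hI : ideal (gen xs) := @gen_ideal _ _ xs.
have qI : gen xs q.
  by apply: gen_over_mem; [apply: zero_ideal | rewrite xsE mem_rcons mem_head].
have gI p : gen gs p -> gen xs p.
  rewrite xsE gen_rcons; exact: add_principal_sub.
apply: pred_ext => p; split.
  move=> [h [b [/colonE h1 ->]]]; apply: idealD => //; last exact: idealMl.
  move: h1; rewrite /= gen_over_add; last exact: zero_ideal.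
  move=> [c [u [gc ehq]]].
  have [_ rq] := nonzerodiv_q hg regular_gens.
  have ea : a = a.-1.+1 by lia.
  have : gen gs (h - u * q ^+ a.-1).
    apply: rq; have -> : q * (h - u * q ^+ a.-1) = h * q - u * q ^+ a.
      by rewrite {2}ea exprS; ring.
    by rewrite ehq addrK.
  move/gI => h1; apply: (ideal_sub_trans hI h1); apply: idealMl => //.
  have -> : a.-1 = a.-2.+1 by lia.
  by rewrite exprSr; apply: idealMl.
rewrite xsE gen_rcons => -[c [u [gc ->]]]; exists c, u; split=> //.
apply/colonE; apply: ideal_mulr; first exact: gen_ideal.
by rewrite /= gen_over_add; [apply: add_principal_sub | apply: zero_ideal].
Qed.

(** If a form [h] vanishes at the points off [q = 0], then [h * q] vanishes at all the points, so it
    annihilates [F] and [h] lies in the colon ideal. *)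
Lemma rank_lower_bound r : power_sum_len F r -> (\prod_(i < n) d i <= r)%N.
Proof.
move=> [L [hL eF]]; have [M [h0 hs]] := HF_xs.
pose y j i := (L j)@_U_(i).
have eF' : F = \sum_j lform (y j) ^+ (msize F).-1.
  by rewrite {1}eF; apply: eq_bigr => j _; rewrite -(homog1_lform (hL j)).
have hvan i h : h \is i.-homog -> van y q h -> gen xs h.
  move=> hh vh; rewrite -quotient_by_q; apply: add_principal_sub.
  apply/colonE; rewrite -perpE /perp eF'.
  apply: (apolar_vanishing _ (dhomogM hh hq)) => j; rewrite mevalM.
  have [->|qj] := eqVneq q.@[y j] 0; first by rewrite mulr0.
  by have := vh i j qj; rewrite pihomog_dE // => ->; rewrite mul0r.
have qI : gen xs q.
  by apply: gen_over_mem; [apply: zero_ideal | rewrite xsE mem_rcons mem_head].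
have := HF_lower_bound hq (@gen_ideal _ _ xs) qI q_neq0 hvan h0.
by rewrite hs mulnC leq_pmul2l.
Qed.

(** A constant [F] is annihilated by a variable, whereas all generators of [perp F] have degree at
    least [a * e], which is at least 2. *)
Lemma D_gt0 : (0 < D)%N.
Proof.
rewrite lt0n; apply/eqP => D0; move: hF; rewrite D0 => h0.
have e1 : F = (F@_0)%:MP by apply: msize1_polyC; apply: msize_homog.
have : perp F 'X_ord0.
  rewrite /perp /apolar msuppX big_seq1 mcoeffX eqxx scale1r mderivmU1m e1.
  exact: mderivC.
rewrite perpE => /gen_low_degree - /(_ 1%N) h.
have : pihomog mdeg 1 ('X_ord0 : P) = 0.
  apply: h => f; rewrite in_cons => /orP[/eqP ->|/mapP [i _ ->]].
    exists (a * e)%N => //; nia.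
  by exists (d i) => //; apply: leq_trans (hd1 i); nia.
rewrite pihomog_dE; last by rewrite dhomogX; apply/eqP/mdeg1.
by move/eqP; rewrite (negPf (X_neq0 _ _)).
Qed.

Definition proportional (y z : 'I_n.+1 -> k) := exists c, forall i, y i = c * z i.

(* Zeros of the deformed ideal come in orbits of size [e] under the roots of
   unity of order [e], so at most [deg / e] of them are pairwise non-proportional. *)
Lemma max_nonproportional (Z : ('I_n.+1 -> k) -> Prop) R :
  (forall r (y : 'I_r -> 'I_n.+1 -> k), (forall j, Z (y j)) ->
     (forall j j', j != j' -> exists i, y j i != y j' i) -> (r <= R * e)%N) ->
  (forall y c, Z y -> c ^+ e = 1 -> Z (fun i => c * y i)) ->
  (forall y, Z y -> exists i, y i != 0) ->
  exists s (y : 'I_s -> 'I_n.+1 -> k), [/\ (s <= R)%N, forall j, Z (y j)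
    & forall z, Z z -> exists j, proportional z (y j)].
Proof.
move=> bound stable nz.
(* Only a later point is compared with the earlier ones, so appending a point requires a single kind
   of check. *)
pose indep s (y : nat -> 'I_n.+1 -> k) := (forall j, (j < s)%N -> Z (y j)) /\
  forall j j', (j' < j < s)%N -> ~ proportional (y j) (y j').
have indep_le s y : indep s y -> (s <= R)%N.
  move=> [hZ hp]; have [zeta [zi z1]] := roots_of_unity hk he.
  pose Y (t : 'I_#|{: 'I_e * 'I_s}|) i := zeta (enum_val t).1 * y (enum_val t).2 i.
  suff : (#|{: 'I_e * 'I_s}| <= R * e)%N.
    by rewrite card_prod !card_ord [(e * s)%N]mulnC leq_pmul2r.
  apply: (bound _ Y); first by move=> t; apply: stable; [apply: hZ | apply: z1].
  move=> t t' ne; apply: NNPP => eY; case/eqP: ne; apply: enum_val_inj.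
  have {}eY i : zeta (enum_val t).1 * y (enum_val t).2 i =
                zeta (enum_val t').1 * y (enum_val t').2 i.
    by apply/eqP/negPn/negP => h; apply: eY; exists i.
  move: eY; case: (enum_val t) => u v; case: (enum_val t') => u' v' /= eY.
  have zu w : zeta w != 0.
    apply/eqP => z0; have := z1 w; rewrite z0 expr0n gtn_eqF // => /esym/eqP.
    by rewrite oner_eq0.
  have [/eqP evv|] := boolP (v == v').
    rewrite -evv in eY *; have [i yi] := nz _ (hZ v (ltn_ord v)).
    by have /(mulIf yi) /zi -> := eY i.
  rewrite neq_ltn => /orP[lt|lt]; exfalso.
    apply: (hp v' v); first by rewrite lt ltn_ord.
    exists ((zeta u')^-1 * zeta u) => i.
    by rewrite -mulrA eY mulKf.
  apply: (hp v v'); first by rewrite lt ltn_ord.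
  exists ((zeta u)^-1 * zeta u') => i.
  by rewrite -mulrA -eY mulKf.
(* A family that cannot be extended exists because lengths are at most [R]; every further point is
   then proportional to a member. *)
have [s [y [hy maxs]]] : exists s y, indep s y /\ forall y', ~ indep s.+1 y'.
  apply: NNPP => no.
  have all s : exists y, indep s y.
    elim: s => [|s [y hy]].
      by exists (fun _ _ => 0); split=> // j j'; rewrite ltn0 andbF.
    by apply: NNPP => h; apply: no; exists s, y; split=> // y' hy'; apply: h; exists y'.
  by have [y /indep_le] := all R.+1; rewrite ltnn.
exists s, (fun j => y j); split; first exact: indep_le hy.
  by move=> j; apply: (proj1 hy).
move=> z Zz; apply: NNPP => h.
apply: (maxs (fun j => if (j < s)%N then y j else z)); split.
  by move=> j _; case: ifP => // /(proj1 hy).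
move=> j j' /andP[lt]; rewrite ltnS leq_eqVlt => /orP[/eqP ej|lt'].
  rewrite ej ltnn in lt *; rewrite lt => p; apply: h.
  by exists (Ordinal lt).
rewrite lt' (ltn_trans lt lt'); apply: (proj2 hy).
by rewrite lt lt'.
Qed.

Lemma rank_upper_bound : exists2 s, power_sum_len F s & (s <= \prod_(i < n) d i)%N.
Proof.
have [M [h0 hs]] := HF_xs.
have hI := @gen_ideal _ _ xs.
have [b [deg]] := graded_basis hI h0; rewrite hs.
(* Positivity lets the length be written [N.+1], the size used for the multiplication matrices. *)
have : (0 < (\prod_(i < n) d i) * e)%N.
  rewrite muln_gt0 he andbT prodn_gt0 // => i.
  by apply: leq_trans (hd1 i).
case eN : (_ * e)%N => [|N] // _ /= [hb sb fb].
(* The exponents are chosen so that [h i * q ^+ a] has the degree of [g i]; the exponent 0 at the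
   last index turns [q] into [q - t]. *)
pose m := glue (fun i => d i - a * e)%N 0%N.
have hm i : (m i < dx i)%N.
  case: (unliftP ord_max i) => [j|] ->; rewrite /m ?glue_lift ?glue_max //.
  by have := hd1 j; lia.
have sb' dd p : p \is dd.-homog ->
    exists v : 'I_N.+1 -> k, gen xs (p - \sum_j v j *: b j).
  by move=> hp; have [v hv] := sb dd p hp; exists (fun j => v j).
have fb' dd (v : 'I_N.+1 -> k) : gen xs (\sum_(j : 'I_N.+1 | deg j == dd) v j *: b j) ->
    forall j : 'I_N.+1, deg j = dd -> v j = 0.
  move=> Iv j ej; have := fb dd (fun j => v (inord j)) _ j (ltn_ord j) ej.
  rewrite inord_val; apply; rewrite (eq_bigr (fun j : 'I_N.+1 => v j *: b j)) //.
  by move=> i _; rewrite inord_val.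
have hb' (j : 'I_N.+1) : b j \is (deg j).-homog by apply: hb.
have [c [t0 rad bound]] := generic_radical x_homog hm regular_xs hb' sb' fb' hk
  (glue_max (fun i => d i - a * e)%N 0%N).
set t := \sum_l _ in t0.
pose h j : P := \sum_l c (lift ord_max j) l *: 'X_l ^+ (d j - a * e).
have hh j : h j \is (d j - a * e).-homog.
  by apply: rpred_sum => l _; apply: rpredZ; apply: homogXX.
have defI : [seq x i - \sum_l c i l *: 'X_l ^+ m i | i <- enum 'I_n.+1] =
    rcons [seq g j - h j | j <- enum 'I_n] (q - t%:MP).
  rewrite -glue_map; apply: eq_map => i.
  case: (unliftP ord_max i) => [j|] ->; rewrite /m ?glue_lift // !glue_max.
  congr (_ - _); rewrite raddf_sum; apply: eq_bigr => l _.
  by rewrite expr0 -mul_mpolyC mulr1.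
rewrite defI in rad bound; set I := gen _ in rad bound.
(* The homogeneous version of [g j - h j], with [q ^+ a / t ^+ a] in place of 1. It agrees with
   [g j] modulo [q ^+ a] and with [g j - h j] modulo [q - t]. *)
pose G j := g j - (t ^- a)%:MP * h j * q ^+ a.
have hG j : G j \is (d j).-homog.
  apply: rpredB; first exact: hg.
  have := dhomogM (dhomogZ (t ^- a) (hh j)) hqa.
  by rewrite mul_mpolyC subnK // hd1.
have regG : regular_over (fun p : P => p = 0) (q ^+ a :: [seq G j | j <- enum 'I_n]).
  apply: regular_mod_congr regular_gens; first by rewrite !size_map.
  move=> i; rewrite size_map => lt; have lt' : (i < n)%N by rewrite -(size_enum_ord n).
  rewrite (nth_map (Ordinal lt') 0 g lt) (nth_map (Ordinal lt') 0 G lt) /G opprB.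
  by rewrite addrCA subrr addr0; apply: add_principal_mul; apply: zero_ideal.
have [_ nzdG] := nonzerodiv_q hG regG.
pose JG := gen [seq G j | j <- enum 'I_n].
have hJG : ideal JG := @gen_ideal _ _ _.
have GF p : JG p -> perp F p.
  rewrite perpE; apply: gen_over_min; first exact: gen_ideal.
    by move=> _ ->; apply: ideal0; apply: gen_ideal.
  move=> _ /mapP [j _ ->]; apply: idealB; first exact: gen_ideal.
    apply: gen_over_mem; first exact: zero_ideal.
    by rewrite in_cons map_f ?orbT // mem_enum.
  apply: idealMl; first exact: gen_ideal.
  by apply: gen_over_mem; [apply: zero_ideal | rewrite mem_head].
have IG p : I p -> exists u, JG (p - u * (q - t%:MP)).
  have -> : (exists u, JG (p - u * (q - t%:MP))) <-> add_principal JG (q - t%:MP) p.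
    split=> [[u hu]|[w [u [hw ->]]]]; last by exists u; rewrite addrK.
    by exists (p - u * (q - t%:MP)), u; rewrite subrK.
  have hA := add_principal_ideal (q - t%:MP) hJG.
  apply: (gen_over_min hA); first by move=> _ ->; apply: (ideal0 hA).
  move=> f; rewrite mem_rcons in_cons => /orP[/eqP ->|/mapP [j _ ->]].
    exact: add_principal_gen.
  have -> : g j - h j = G j + (t ^- a)%:MP * h j * (q ^+ a - t%:MP ^+ a).
    rewrite /G mulrBr [X in _ = _ + (_ - X)](_ : _ = h j); first by ring.
    by rewrite mulrAC -rmorphXn -mpolyCM /= mulVf ?expf_neq0 // mul1r.
  apply: (idealD hA).
    apply: add_principal_sub; apply: gen_over_mem; first exact: zero_ideal.
    by rewrite map_f // mem_enum.
  apply: (idealMl hA); rewrite subrXX mulrC; apply: (idealMl hA).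
  exact: add_principal_gen.
have zI z : zero_of I z <-> q.@[z] = t /\ forall j, (g j).@[z] = (h j).@[z].
  rewrite zero_of_gen; split=> [hz|[z1 z2] f].
    split=> [|j]; apply/eqP; rewrite -subr_eq0; apply/eqP.
      rewrite -[t in LHS](mevalC z) -mevalB; apply: hz.
      by rewrite mem_rcons mem_head.
    rewrite -mevalB; apply: hz; rewrite mem_rcons in_cons; apply/orP; right.
    by apply/mapP; exists j; rewrite ?mem_enum.
  rewrite mem_rcons in_cons => /orP[/eqP ->|/mapP [j _ ->]].
    by rewrite mevalB mevalC z1 subrr.
  by rewrite mevalB z2 subrr.
have [|y w /zI [z1 z2] w1|y /zI [z1 _]|s [y [les hy hprop]]] :=
  @max_nonproportional (zero_of I) (\prod_(i < n) d i)%N.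
- by move=> r y hy dy; rewrite eN; apply: bound hy dy.
- apply/zI; split=> [|j]; first by rewrite (meval_scale _ _ hq) w1 mul1r.
  rewrite (meval_scale _ _ (hg j)) (meval_scale _ _ (hh j)) z2.
  (* The degrees of [g j] and [h j] differ by [a * e], so both scale alike under a root of unity of
     order dividing [e]. *)
  by rewrite -{1}(subnK (hd1 j)) exprD mulnC exprM w1 expr1n mulr1.
(* The origin is excluded because [q] vanishes there and [t] does not. *)
- apply: NNPP => no; case/eqP: t0; rewrite -z1.
  have y0 : y =1 (fun=> 0).
    by move=> i; apply/eqP/negPn/negP => yi; apply: no; exists i.
  by rewrite (meval_eq _ y0); apply: homog_eval0 hq.
exists s => //.
(* A form vanishing at the representatives vanishes at all zeros of [I], so reducedness puts it in
   [I], and [homog_descent] brings it down to [JG]. *)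
have [p hp pv|c' eF] := @apolar_duality _ _ hk F D s y hF.
  apply: GF; have [|u hu] := IG p.
    apply: rad => z hz; have [j [w ez]] := hprop z hz.
    by rewrite (meval_eq _ ez) (meval_scale _ _ hp) pv mulr0.
  by apply: (homog_descent hJG _ hq he t0 nzdG hp hu);
     apply: gen_over_graded (gs_homog hG); [apply: zero_ideal | apply: zero_graded].
exact: power_sum_of_lincomb D_gt0 hF F_neq0 eF.
Qed.

Lemma wrank_CI : wrank F = (\prod_(i < n) d i)%N.
Proof.
have [s hs les] := rank_upper_bound; have [hw ltw] := wrank_spec hs.
apply/eqP; rewrite eqn_leq (leq_trans ltw les) /=; exact: rank_lower_bound.
Qed.

Lemma HFsum_CI : HFsum (gen xs) = ((\prod_(i < n) d i) * e)%N.
Proof. by have [M [h0 <-]] := HF_xs; apply: HFsumE. Qed.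

Lemma rank_by_q :
  (wrank F)%:R = (e%:R)^-1 *
    (HFsum (add_principal (colon (perp F) (ideal_of [:: q])) q))%:R :> rat.
Proof.
rewrite quotient_by_q HFsum_CI wrank_CI natrM mulrC mulfK //.
by rewrite Num.Theory.pnatr_eq0 -lt0n.
Qed.

Lemma computes_q : computes F e [:: q].
Proof.
(* The general element is [c *: q] with [c] nonzero, which generates the same ideal as [q]. *)
exists 'X_ord0; split=> [|c]; first exact: X_neq0.
rewrite mevalXU big_ord1 /= => c0; rewrite rank_by_q; do 3!congr (_ _).
have hK : ideal (colon (perp F) (ideal_of [:: q])).
  have hI : ideal (perp F) by rewrite perpE; apply: gen_ideal.
  split=> [f _|p p' h h' f hf|p p' h f hf]; first by rewrite mul0r; apply: ideal0.
    by rewrite mulrDl; apply: idealD => //; [apply: h | apply: h'].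
  by rewrite -mulrA; apply: idealMl => //; apply: h.
apply: pred_ext => p; split; apply: add_principal_min;
  try exact: add_principal_ideal; try exact: add_principal_sub.
  have := idealZ (c ord0)^-1 (add_principal_ideal _ hK)
    (add_principal_gen (c ord0 *: q) hK).
  by rewrite scalerA mulVf // scale1r.
by apply: idealZ; [apply: add_principal_ideal | apply: add_principal_gen].
Qed.

End Main.

Theorem theorem4p14 (k : closedFieldType) (hk : [pchar k] =i pred0)
  (n : nat) (F : {mpoly k[n.+1]}) (D : nat) (hF : F \is D.-homog)
  (q : {mpoly k[n.+1]}) (g : 'I_n -> {mpoly k[n.+1]})
  (a e : nat) (d : 'I_n -> nat)
  (hq : q \is e.-homog) (hg : forall i, g i \is (d i).-homog)
  (ha : (2 <= a)%N) (he : (0 < e)%N)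
  (hd1 : forall i : 'I_n, (a * e <= d i)%N)
  (hdmono : forall i j : 'I_n, (i <= j)%N -> (d i <= d j)%N)
  (hCI : complete_intersection_by (perp F)
           (q ^+ a :: [seq g i | i <- enum 'I_n])) :
  e_computable F e /\ computed_by F q /\
  wrank F = (\prod_(i < n) d i)%N /\
  ((wrank F)%:R : rat) =
    (e%:R)^-1 * (HFsum (add_principal (colon (perp F) (ideal_of [:: q])) q))%:R.
Proof.
have q0 := q_neq0 ha hCI.
have cq := computes_q hk hF hq hg ha he hd1 hCI.
split; [exists [:: q]; split; [|split] | split; [|split]] => //.
- by move=> j; rewrite ord1.
- move=> c; rewrite big_ord1 /= => /eqP; rewrite scaler_eq0 (negPf q0) orbF.
  by move=> /eqP c0 i; rewrite ord1.
(* For the nonzero form [q] the number [(msize q).-1] is its degree [e]. *)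
- rewrite /computed_by; have -> : (msize q).-1 = e; last exact: cq.
  exact: (dhomog_uniq q0 (dhomog_msize hq) hq).
- exact: (wrank_CI hk hF hq hg ha he hd1 hCI).
- exact: (rank_by_q hk hF hq hg ha he hd1 hCI).
Qed.
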